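(* For every $(a_1,a_2,a_3,a_4)\in[0,\infty]^4$ with $a_1\le a_2\le a_3\le a_4$, there exists an ultrametric space $(X,d)$ which is homeomorphic to the Cantor set and satisfies \[ \dim_H(X,d)=a_1,\quad \dim_P(X,d)=a_2,\quad \overline{\dim}_B(X,d)=a_3,\quad \dim_A(X,d)=a_4. \]
   Context: A metric $d$ on $X$ is an ultrametric if $d(x,y)\le \max\{d(x,z),d(z,y)\}$ for all $x,y,z\in X$. For a metric space $(X,d)$, $B(x,r)$ denotes the closed ball with center $x$ and radius $r$, and subsets carry the restricted metric. Hausdorff dimension: for $s\in[0,\infty)$ and $\delta>0$ let $\mathcal H^s_\delta(A)=\inf\{\sum_{i\ge1}\mathrm{diam}(A_i)^s : A\subset\bigcup_{i\ge 1}A_i,\ \mathrm{diam}(A_i)<\delta\}$ and $\mathcal H^s(A)=\sup_{\delta>0}\mathcal H^s_\delta(A)$; then $\dim_H(X,d)=\inf\{s\in[0,\infty):\mathcal H^s(X)=0\}$ (with $\inf\emptyset=\infty$). Packing dimension (radius-type): for $A\subset X$, $s\in[0,\infty)$ and $\delta>0$, let $\widetilde{\mathcal P}^s_\delta(A)$ be the supremum of $\sum_i r_i^s$ over all finite or countable sequences $\{r_i\}$ in $(0,\delta)$ for which there are points $x_i\in A$ such that the closed balls $B(x_i,r_i)$ are pairwise disjoint. Put $\widetilde{\mathcal P}^s_0(A)=\inf_{\delta>0}\widetilde{\mathcal P}^s_\delta(A)$ and $\mathcal P^s(A)=\inf\{\sum_{i\ge1}\widetilde{\mathcal P}^s_0(S_i):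 A\subset\bigcup_{i\ge1}S_i\}$; then $\dim_P(X,d)=\inf\{s\in[0,\infty):\mathcal P^s(X)=0\}$ (with $\inf\emptyset=\infty$). Upper box dimension: $N_d(X,r)$ is the least cardinality of a subset $A\subset X$ with $X=\bigcup_{a\in A}B(a,r)$, and $\overline{\dim}_B(X,d)=\limsup_{r\to0}\frac{\log N_d(X,r)}{-\log r}$. Assouad dimension: $\dim_A(X,d)$ is the infimum of all $\lambda\in(0,\infty)$ for which there is $C\in(0,\infty)$ such that $N_d(B(x,R),r)\le C(R/r)^\lambda$ for all $x\in X$ and all $R>r>0$; it is $\infty$ if no such $\lambda$ exists. *)

(* Defs.v *)
From HB Require Import structures.
From mathcomp Require Import all_boot all_order all_algebra finmap.
From mathcomp Require Import all_classical all_reals all_analysis.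

Set Implicit Arguments.
Unset Strict Implicit.
Unset Printing Implicit Defensive.

Import Order.TTheory GRing.Theory Num.Theory.
Import numFieldNormedType.Exports.

Local Open Scope classical_set_scope.
Local Open Scope ring_scope.
Local Open Scope ereal_scope.

Definition homeomorphic (X Y : topologicalType) : Prop :=
  exists (f : X -> Y) (g : Y -> X),
    [/\ continuous f, continuous g, cancel f g & cancel g f].

Section dimensions.
Context {R : realType} (X : metricType R).
Implicit Types (A : set X) (x y z : X) (r s delta : R).

Definition ultrametric : Prop := forall x y z,
  (mdist x y <= Num.max (mdist x z) (mdist z y))%R.

(* Not the library's [closed_ball], which is the closure of the open ball:
   the two differ in ultrametric spaces. *)
Definition cball x r : set X := [set y | (mdist x y <= r)%R].

(* The maximum with 0 gives the empty set diameter 0 instead of -oo. *)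
Definition diam A : \bar R :=
  maxe 0 (ereal_sup [set (mdist x y)%:E | x in A & y in A]).

(* [poweR] takes 0 to the power 0 to be 1; empty members of a cover must
   contribute 0 even when s = 0, so that finite covers can be padded. *)
Definition diam_pow s A : \bar R :=
  if A == set0 then 0 else poweR (diam A) s.

Definition hausdorff_premeasure s delta A : \bar R :=
  ereal_inf [set \sum_(0 <= i <oo) diam_pow s (F i) |
    F in [set F : nat -> set X |
      A `<=` \bigcup_i F i /\ forall i, diam (F i) < delta%:E]].

Definition hausdorff_measure s A : \bar R :=
  ereal_sup [set hausdorff_premeasure s delta A |
    delta in [set delta : R | (0 < delta)%R]].

Definition hausdorff_dim : \bar R :=
  ereal_inf [set s%:E |
    s in [set s : R | (0 <= s)%R /\ hausdorff_measure s setT = 0]].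

(* A finite or countable family of closed balls is indexed by an arbitrary
   subset I of nat; outside I the values of c and r are irrelevant. *)
Definition is_packing A delta (I : set nat) (c : nat -> X) (r : nat -> R) :=
  [/\ forall i, I i -> (0 < r i < delta)%R,
      forall i, I i -> A (c i) &
      trivIset I (fun i => cball (c i) (r i))].

Definition packing_premeasure s delta A : \bar R :=
  ereal_sup [set S | exists (I : set nat) (c : nat -> X) (r : nat -> R),
    is_packing A delta I c r /\ S = \esum_(i in I) (powR (r i) s)%:E].

Definition packing_premeasure0 s A : \bar R :=
  ereal_inf [set packing_premeasure s delta A |
    delta in [set delta : R | (0 < delta)%R]].

Definition packing_measure s A : \bar R :=
  ereal_inf [set \sum_(0 <= i <oo) packing_premeasure0 s (F i) |
    F in [set F : nat -> set X | A `<=` \bigcup_i F i]].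

Definition packing_dim : \bar R :=
  ereal_inf [set s%:E |
    s in [set s : R | (0 <= s)%R /\ packing_measure s setT = 0]].

(* N(A, r) for the subspace A, so the centers are taken in A; it is +oo when
   A has no finite r-net. *)
Definition covering_number A r : \bar R :=
  ereal_inf [set (#|` E|%:R)%:E |
    E in [set E : {fset X} | [set` E] `<=` A /\
                             A `<=` \bigcup_(a in [set` E]) cball a r]].

Definition upper_box_dim : \bar R :=
  limf_esup (fun r : R => lne (covering_number setT r) / (- ln r)%:E) 0^'+.

Definition assouad_dim : \bar R :=
  ereal_inf [set l%:E | l in [set l : R | (0 < l)%R /\
    exists C : R, (0 < C)%R /\
      forall (x : X) (r1 r2 : R), (0 < r2)%R -> (r2 < r1)%R ->
        covering_number (cball x r1) r2 <= (C * powR (r1 / r2) l)%:E]].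

End dimensions.

(* Main.v *)
From HB Require Import structures.
Require Import Defs.
From mathcomp Require Import all_boot all_order all_algebra finmap.
From mathcomp Require Import all_classical all_reals all_analysis.
From mathcomp Require Import zify ring lra.

(** The space is the set of binary sequences, with an ultrametric all of whose
    nonzero distances are powers of two.  Sequences are sorted into pieces
    according to the number [k] of entries [true] that they start with; the
    [k]-th piece has diameter at most [2^-k], and the pieces accumulate at the
    constant sequence [true].  Each piece is homogeneous: for [m > k] it splits
    into [2^(M k m)] balls of radius [2^-m], which are cylinders of length
    [k + 1 + M k m].  The metric induces the product topology for every profile
    [M] ([pspace_homeomorphic]), and the dimensions can be read off the growth
    of [M]:
    - Hausdorff ([hausdorff_dim_le], [hausdorff_dim_ge]): if [M k m <= s m] for
      all [k], for infinitely many [m], then the balls of radius [2^-m] give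
      efficient covers of the whole space; if [M 0 m >= s m - b] for all [m],
      then a mass distribution on the [0]-th piece forbids efficient covers;
    - packing ([packing_dim_le], [packing_dim_ge]): this dimension is countably
      stable, so a bound [M k m <= s m + b k] with [b k] depending on the piece is
      enough from above (Kraft's inequality bounds the sums of the packings of
      one piece); from below, [M 0 m >= s m] for infinitely many [m] is enough,
      since by Baire's argument some member of any countable cover is dense in
      some cylinder;
    - upper box ([box_dim_le], [box_dim_ge]): the bound from above must be uniform
      in [k], and from below it suffices that [M k m - M k (k + 1) >= s m] for
      pairs [(k, m)] with [m] arbitrarily large;
    - Assouad ([assouad_dim_le], [assouad_dim_ge]): from above,
      [M k n - M k m <= s (n - m) + b] uniformly; from below, the quantities
      [M k n - M k m - s (n - m)] must be unbounded above.

    Thus the upper box and Assouad dimensions see deviations of the [k]-th piece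
    on a range of scales that depends on [k], while the Hausdorff and packing
    dimensions need not.  The scales are cut into blocks, each much longer than
    all the preceding ones.  Every piece grows at rate [a1] on even blocks and at
    rate [a2] on odd blocks, so that its average rate oscillates between [a1] and
    [a2].  On the [k]-th block, for odd [k], the [k]-th piece alone deviates: it
    grows first at rate [a4], for a time [k] too short to affect the averages,
    and then at rate [a3].  The rates are never less than [a1], and at the end of
    an even block all the deviations are either outweighed or still to come,
    hence the Hausdorff dimension is [a1]; each piece deviates on at most one
    block, hence the packing dimension is [a2].  Infinite rates are replaced on
    the [i]-th block by their truncations at [i], and a harmonic term of rate
    tending to 0 keeps the growth unbounded when all rates vanish. *)

Set Implicit Arguments.
Unset Strict Implicit.
Unset Printing Implicit Defensive.

Import Order.TTheory GRing.Theory Num.Theory.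
Import numFieldNormedType.Exports.

Local Open Scope classical_set_scope.
Local Open Scope ring_scope.

(** * Binary sequences and cylinders *)

(** [x] and [y] lie in the same cylinder of length [n]. *)
Definition agree (n : nat) (x y : nat -> bool) : bool :=
  all (fun i => x i == y i) (iota 0 n).

Lemma agreeP n (x y : nat -> bool) :
  reflect (forall i, (i < n)%N -> x i = y i) (agree n x y).
Proof.
apply: (iffP allP) => [h i ni|h i].
  by apply/eqP/h; rewrite mem_iota.
by rewrite mem_iota => /andP[_ ni]; apply/eqP/h.
Qed.

Lemma agree_refl n x : agree n x x.
Proof. exact/agreeP. Qed.

Lemma agree_sym n x y : agree n x y = agree n y x.
Proof. by apply/agreeP/agreeP => h i ni; rewrite h. Qed.

Lemma agree_trans n : transitive (agree n).
Proof.
by move=> y x z /agreeP xy /agreeP yz; apply/agreeP => i ni; rewrite xy// yz.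
Qed.

Lemma agree_le m n x y : (m <= n)%N -> agree n x y -> agree m x y.
Proof.
by move=> mn /agreeP h; apply/agreeP => i im; rewrite h// (leq_trans im).
Qed.

Lemma agreeS n x y : agree n.+1 x y = agree n x y && (x n == y n).
Proof. by rewrite /agree -[n.+1]addn1 iotaD all_cat /= andbT. Qed.

(** The sequence that follows [x] up to position [n], then the word [t], and is
    constantly [false] afterwards. *)
Definition graft (x : nat -> bool) (n : nat) (t : seq bool) : nat -> bool :=
  fun i => if (i < n)%N then x i else nth false t (i - n).

Lemma graft_agree x n t : agree n (graft x n t) x.
Proof. by apply/agreeP => i ni; rewrite /graft ni. Qed.

Lemma graftE x n t i : graft x n t (n + i)%N = nth false t i.
Proof. by rewrite /graft ltnNge leq_addr/= addnC addnK. Qed.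

(** The [p] entries of [x] that follow position [n]. *)
Definition window (n p : nat) (x : nat -> bool) : p.-tuple bool :=
  [tuple x (n + i)%N | i < p].

Lemma window_graft n p x (t : p.-tuple bool) : window n p (graft x n t) = t.
Proof.
by apply: eq_from_tnth => i; rewrite tnth_mktuple graftE (tnth_nth false).
Qed.

Lemma agree_window n p x y :
  agree (n + p) x y = agree n x y && (window n p x == window n p y).
Proof.
apply/idP/andP => [xy|[/agreeP xy /eqP e]].
  split; first by apply: agree_le xy; rewrite leq_addr.
  apply/eqP/eq_from_tnth => i; rewrite !tnth_mktuple.
  by move/agreeP : xy => ->//; rewrite ltn_add2l.
apply/agreeP => i inp; case: (ltnP i n) => [/xy//|ni].
have ip : (i - n < p)%N by lia.
have := congr1 (fun t => tnth t (Ordinal ip)) e.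
by rewrite !tnth_mktuple/= subnKC.
Qed.

Lemma agree_graft n p x y : agree n x y ->
  agree (n + p) (graft x n (window n p y)) y.
Proof.
move=> xy; rewrite agree_window window_graft eqxx andbT.
exact: agree_trans (graft_agree _ _ _) xy.
Qed.

(** * Cut functions *)

(** [prof k m] is the binary logarithm of the number of balls of radius [2^-m]
    needed to cover the [k]-th piece of the space.  The [k]-th piece has diameter
    at most [2^-k], hence the normalization [prof_diag]. *)
Record profile := Profile {
  prof :> nat -> nat -> nat ;
  prof_step : forall k m, (prof k m <= prof k m.+1)%N ;
  prof_diag : forall k, prof k k = 0%N ;
  prof_unbounded : forall k b, exists m, (b <= prof k m)%N }.

Lemma prof_le (M : profile) k m n : (m <= n)%N -> (M k m <= M k n)%N.
Proof.
move=> mn; apply: (homo_leq (r := leq)) mn => //; first exact: leq_trans.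
exact: prof_step.
Qed.

Lemma prof0 (M : profile) k m : (m <= k)%N -> M k m = 0%N.
Proof. by move=> /(prof_le M k); rewrite prof_diag; lia. Qed.

(** The length of the longest prefix of [x] of length at most [m] all of whose
    entries are [true]. *)
Definition lead (x : nat -> bool) (m : nat) : nat :=
  find (fun i => ~~ x i) (iota 0 m).

Lemma lead_le x m : (lead x m <= m)%N.
Proof. by rewrite /lead (leq_trans (find_size _ _))// size_iota. Qed.

Lemma lead_true (x : nat -> bool) m i : (i < lead x m)%N -> x i.
Proof.
move=> im; have := before_find 0%N im.
by rewrite nth_iota ?(leq_trans im (lead_le _ _))// add0n => /negbFE.
Qed.

Lemma lead_false x m : (lead x m < m)%N -> x (lead x m) = false.
Proof.
move=> lm; have : has (fun i => ~~ x i) (iota 0 m).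
  by rewrite has_find size_iota.
by move=> /(nth_find 0%N); rewrite nth_iota// add0n => /negbTE.
Qed.

Lemma leadE (x : nat -> bool) m k : (k < m)%N -> (forall i, (i < k)%N -> x i) ->
  x k = false -> lead x m = k.
Proof.
move=> km xt xf; have [kl|lk|//] := ltngtP (lead x m) k.
  by have := lead_false (ltn_trans kl km); rewrite xt.
by have := lead_true lk; rewrite xf.
Qed.

Lemma leadT (x : nat -> bool) m : (forall i, (i < m)%N -> x i) -> lead x m = m.
Proof.
move=> xt; apply/eqP; rewrite eqn_leq lead_le leqNgt; apply/negP => lm.
by have := lead_false lm; rewrite xt.
Qed.

(** The number of entries of [x] that determine its ball of radius [2^-m]: the
    leading entries [true], the entry [false] that ends them if it occurs before
    position [m], and the entries prescribed by the profile of the piece. *)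
Definition cut (M : profile) (x : nat -> bool) (m : nat) : nat :=
  (lead x m + (lead x m < m) + M (lead x m) m)%N.

Section cut.
Variable M : profile.
Implicit Types (x y z : nat -> bool) (k m n : nat).

Lemma cut_piece x m k : (k < m)%N -> (forall i, (i < k)%N -> x i) ->
  x k = false -> cut M x m = (k.+1 + M k m)%N.
Proof. by move=> km xt xf; rewrite /cut (leadE km xt xf) km addn1. Qed.

Lemma cut_spine x m : (forall i, (i < m)%N -> x i) -> cut M x m = m.
Proof. by move=> xt; rewrite /cut leadT// ltnn prof_diag !addn0. Qed.

Lemma leadP x m : (forall i, (i < m)%N -> x i) \/
  exists k, [/\ (k < m)%N, forall i, (i < k)%N -> x i & x k = false].
Proof.
have := lead_le x m; rewrite leq_eqVlt => /orP[/eqP e|lm].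
  by left=> i im; apply: (@lead_true x m); rewrite e.
right; exists (lead x m); split=> //; first exact: lead_true.
exact: lead_false.
Qed.

Lemma cut_agree x y m : agree (cut M x m) x y -> cut M x m = cut M y m.
Proof.
have [xt|[k [km xt xf]]] := leadP x m.
  rewrite (cut_spine xt) => /agreeP xy; rewrite cut_spine// => i im.
  by rewrite -xy// xt.
rewrite (cut_piece km xt xf) => /agreeP xy; rewrite (@cut_piece y m k)//.
  by move=> i ik; rewrite -xy ?xt//; lia.
by rewrite -xy//; lia.
Qed.

Lemma cut_step x m : (cut M x m <= cut M x m.+1)%N.
Proof.
have [xt|[k [km xt xf]]] := leadP x m.
  rewrite (cut_spine xt); have [xm|xm] := boolP (x m).
    rewrite cut_spine// => i; rewrite ltnS leq_eqVlt => /orP[/eqP->//|].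
    exact: xt.
  by rewrite (@cut_piece x m.+1 m)//; [lia|exact/negbTE].
rewrite (cut_piece km xt xf) (@cut_piece x m.+1 k)//; last by lia.
by rewrite leq_add2l prof_step.
Qed.

Lemma cut_le x m n : (m <= n)%N -> (cut M x m <= cut M x n)%N.
Proof.
move=> mn; apply: (homo_leq (r := leq)) mn => //; first exact: leq_trans.
exact: cut_step.
Qed.

Lemma cut0 x : cut M x 0 = 0%N.
Proof. by rewrite cut_spine. Qed.

Lemma cut_unbounded x b : exists m, (b <= cut M x m)%N.
Proof.
have [xt|[k [km xt xf]]] := leadP x b.
  by exists b; rewrite cut_spine.
have [m bm] := prof_unbounded M k b; exists (maxn m k.+1).
rewrite (@cut_piece x _ k)//; last by lia.
rewrite (leq_trans bm)// (leq_trans (prof_le M k (leq_maxl m k.+1)))//.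
by rewrite leq_addl.
Qed.

(** The points [x] and [y] are at distance at most [2^-m]. *)
Definition close (m : nat) (x y : nat -> bool) : bool := agree (cut M x m) x y.

Lemma close0 x y : close 0 x y.
Proof. by rewrite /close cut0. Qed.

Lemma close_refl m x : close m x x.
Proof. exact: agree_refl. Qed.

Lemma close_sym m x y : close m x y = close m y x.
Proof.
by apply/idP/idP => xy; rewrite /close -(cut_agree xy) agree_sym.
Qed.

Lemma close_trans m : transitive (close m).
Proof.
move=> y x z xy yz; move: (xy); rewrite /close => /agree_trans; apply.
by rewrite (cut_agree xy).
Qed.

Lemma close_le m n x y : (m <= n)%N -> close n x y -> close m x y.
Proof. by move=> mn; apply: agree_le; exact: cut_le. Qed.

Lemma close_eq x y : (forall m, close m x y) -> x = y.
Proof.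
move=> xy; apply/funext => i; have [m im] := cut_unbounded x i.+1.
by have /agreeP -> := xy m.
Qed.

Lemma close_piece x m k y : (k < m)%N -> (forall i, (i < k)%N -> x i) ->
  x k = false -> close m x y = agree (k.+1 + M k m) x y.
Proof. by move=> km xt xf; rewrite /close (cut_piece km xt xf). Qed.

(** The ball of radius [2^-m] around [x] has a [2^-n]-net of controlled size:
    either it lies in one piece, or it contains the pieces from the [m]-th on,
    of which those from the [n]-th on lie in a single ball of radius [2^-n]. *)
Lemma close_net x m n D : (m <= n)%N ->
  (forall k, (M k n - M k m <= D)%N) ->
  exists s : seq (nat -> bool),
    [/\ (size s <= (n - m + 1) * 2 ^ D)%N,
        forall y, y \in s -> close m x y &
        forall y, close m x y -> exists2 z, z \in s & close n z y].
Proof.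
move=> mn hD; have [xt|[k [km xt xf]]] := leadP x m.
  (* The net consists of nets of the pieces m, ..., n - 1 and of one point for
     all the following pieces. *)
  pose u k := fun i => (i < k)%N.
  pose pc k := [seq graft (u k) k.+1 t |
    t : (M k n).-tuple bool <- enum {: (M k n).-tuple bool}].
  exists (u n :: flatten [seq pc k | k <- iota m (n - m)]); split.
  - rewrite /= size_flatten /shape -map_comp.
    have szpc k : (k \in iota m (n - m) -> size (pc k) <= 2 ^ D)%N.
      rewrite mem_iota => /andP[mk _].
      rewrite /pc size_map -cardE card_tuple card_bool leq_exp2l//.
      by have := hD k; rewrite (prof0 M mk) subn0.
    have : (sumn [seq size (pc k) | k <- iota m (n - m)] <= (n - m) * 2 ^ D)%N.
      rewrite -[X in (_ <= X * _)%N](size_iota m (n - m)).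
      elim: (iota m (n - m)) szpc => //= a l ih h.
      rewrite mulSn leq_add ?h ?mem_head//.
      by rewrite ih// => k kl; apply: h; rewrite in_cons kl orbT.
    have : (0 < 2 ^ D)%N by rewrite expn_gt0.
    rewrite /comp; lia.
  - move=> y yin; rewrite /close (cut_spine xt).
    suff yt : forall i, (i < m)%N -> y i.
      by apply/agreeP => i im; rewrite xt// yt.
    move: yin; rewrite in_cons => /orP[/eqP -> i im|].
      by rewrite /u (leq_trans im).
    move=> /flatten_mapP[k]; rewrite mem_iota => /andP[mk _] /mapP[t _ ->] i im.
    by rewrite /graft (ltn_trans im)// /u (leq_trans im).
  - move=> y; rewrite /close (cut_spine xt) => /agreeP xy.
    have yt i : (i < m)%N -> y i by move=> im; rewrite -xy// xt.
    have [yn|[k [kn yk yf]]] := leadP y n.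
      exists (u n); first exact: mem_head.
      rewrite cut_spine; last by [].
      by apply/agreeP => i ni; rewrite /u ni yn.
    have mk : (m <= k)%N by rewrite leqNgt; apply/negP => /yt; rewrite yf.
    have uy : agree k.+1 (u k) y.
      apply/agreeP => i; rewrite ltnS leq_eqVlt /u => /orP[/eqP->|ik].
        by rewrite ltnn yf.
      by rewrite ik yk.
    exists (graft (u k) k.+1 (window k.+1 (M k n) y)).
      rewrite in_cons; apply/orP; right; apply/flatten_mapP; exists k.
        by rewrite mem_iota; lia.
      by apply: map_f; rewrite mem_enum.
    rewrite -/(close n _ _) close_sym (close_piece _ kn yk yf) agree_sym.
    exact: agree_graft.
pose p := (M k n - M k m)%N; pose l := (k.+1 + M k m)%N.
have kn : (k < n)%N by rewrite (leq_trans km).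
have lp : (l + p = k.+1 + M k n)%N.
  by rewrite /l /p; have := prof_le M k mn; lia.
exists [seq graft x l t | t : p.-tuple bool <- enum {: p.-tuple bool}]; split.
- rewrite size_map -cardE card_tuple card_bool.
  by rewrite (leq_trans (leq_pexp2l _ (hD k)))// leq_pmull// addn1.
- move=> _ /mapP[t _ ->]; rewrite (close_piece _ km xt xf) agree_sym.
  exact: graft_agree.
- move=> y; rewrite (close_piece _ km xt xf) -/l => xy.
  exists (graft x l (window l p y)); first by apply: map_f; rewrite mem_enum.
  have kl : (k.+1 <= l)%N by rewrite leq_addr.
  move/agreeP: (xy) => xyl.
  rewrite close_sym (@close_piece y n k)//.
  + by rewrite -lp agree_sym agree_graft.
  + by move=> i ik; rewrite -xyl ?xt// (leq_trans ik) 1?ltnW.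
  + by rewrite -xyl.
Qed.

(** Conversely, points of the ball whose words of length [M k n - M k m] after
    the common prefix differ are not in the same ball of radius [2^-n]. *)
Lemma net_size_ge x m n k (s : seq (nat -> bool)) : (k < m)%N -> (m <= n)%N ->
  (forall i, (i < k)%N -> x i) -> x k = false ->
  (forall y, close m x y -> exists2 z, z \in s & close n z y) ->
  (2 ^ (M k n - M k m) <= size s)%N.
Proof.
move=> km mn xt xf hs; pose p := (M k n - M k m)%N; pose l := (k.+1 + M k m)%N.
have kn : (k < n)%N by rewrite (leq_trans km).
have lp : (l + p = k.+1 + M k n)%N.
  by rewrite /l /p; have := prof_le M k mn; lia.
have kl : (k.+1 <= l)%N by rewrite leq_addr.
rewrite -/p -card_bool -card_tuple cardE -(size_map (window l p) s).
apply: uniq_leq_size; first exact: enum_uniq.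
move=> t _; have xg : agree l (graft x l t) x := graft_agree _ _ _.
have [|z zs] := hs (graft x l t).
  by rewrite (close_piece _ km xt xf) agree_sym.
move/agreeP : xg => xg.
rewrite close_sym (@close_piece _ n k)//; first last.
- by rewrite xg.
- by move=> i ik; rewrite xg ?xt// (leq_trans ik) 1?ltnW.
rewrite -lp agree_window => /andP[_ /eqP tz].
by apply/mapP; exists z => //; rewrite -tz window_graft.
Qed.

End cut.

(** * Powers of two with real exponents *)

Section pow2.
Variable R : realType.
Implicit Types (x y s e b : R) (m n : nat).

Definition pow2 x : R := 2 `^ x.

Let pow2E x : pow2 x = expR (x * ln 2).
Proof. by rewrite /pow2 /powR pnatr_eq0. Qed.

Let ln2_gt0 : 0 < ln 2 :> R.
Proof. by rewrite ln_gt0// ltr1n. Qed.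

Lemma pow2_gt0 x : 0 < pow2 x. Proof. by rewrite pow2E expR_gt0. Qed.

Lemma pow2_ge0 x : 0 <= pow2 x. Proof. exact/ltW/pow2_gt0. Qed.

Lemma pow2D x y : pow2 (x + y) = pow2 x * pow2 y.
Proof. by rewrite !pow2E mulrDl expRD. Qed.

Lemma pow2N x : pow2 (- x) = (pow2 x)^-1.
Proof. by rewrite !pow2E mulNr expRN. Qed.

Lemma pow2_0 : pow2 0 = 1. Proof. by rewrite pow2E mul0r expR0. Qed.

Lemma pow2_le x y : (pow2 x <= pow2 y) = (x <= y).
Proof. by rewrite !pow2E ler_expR ler_pM2r. Qed.

Lemma pow2_lt x y : (pow2 x < pow2 y) = (x < y).
Proof. by rewrite !pow2E ltr_expR ltr_pM2r. Qed.

Lemma pow2_ge1 x : (1 <= pow2 x) = (0 <= x).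
Proof. by rewrite -[in RHS]pow2_le pow2_0. Qed.

Lemma pow2_le1 x : (pow2 x <= 1) = (x <= 0).
Proof. by rewrite -[in RHS]pow2_le pow2_0. Qed.

Lemma pow2_nat n : pow2 n%:R = (2 ^ n)%:R.
Proof. by rewrite /pow2 powR_mulrn// natrX. Qed.

Lemma powR_pow2 x s : pow2 x `^ s = pow2 (x * s).
Proof. by rewrite /pow2 powRrM. Qed.

Lemma ln_pow2 x : ln (pow2 x) = x * ln 2.
Proof. by rewrite pow2E expRK. Qed.

Lemma pow2_half n : pow2 (- n.+1%:R) + pow2 (- n.+1%:R) = pow2 (- n%:R).
Proof.
rewrite -[in RHS](addrNK 1 (- n%:R)) pow2D -opprD natr1.
by have -> : pow2 1 = 2 by [rewrite /pow2 powRr1]; ring.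
Qed.

(** Exponentials eventually exceed linear functions: the exponential is the
    square of another one, which is itself at least linear. *)
Lemma pow2_lin e b : 0 < e -> exists m0, forall m, (m0 <= m)%N ->
  b * m.+1%:R <= pow2 (e * m%:R).
Proof.
move=> e0; pose c := e * ln 2 / 2.
have c0 : 0 < c by rewrite !mulr_gt0// invr_gt0.
pose m1 := Num.trunc (`|b| / c ^+ 2); pose m2 := Num.trunc (`|b| / c).
exists (maxn m1 m2).+1 => m; rewrite gtn_max => /andP[mm1 mm2].
have -> : pow2 (e * m%:R) = expR (c * m%:R) ^+ 2.
  by rewrite pow2E -expRM_natl /c; congr expR; field.
have h1 : `|b| <= c ^+ 2 * m%:R.
  rewrite mulrC -ler_pdivrMr ?exprn_gt0// ltW// (lt_le_trans (truncnS_gt _))//.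
  by rewrite ler_nat.
have h2 : `|b| <= c * m%:R.
  rewrite mulrC -ler_pdivrMr// ltW// (lt_le_trans (truncnS_gt _))//.
  by rewrite ler_nat.
apply: (@le_trans _ _ ((1 + c * m%:R) ^+ 2)).
  have bb : b <= `|b| := ler_norm b.
  have m0 : 0 <= m%:R :> R by [].
  have h3 : `|b| * m%:R <= c ^+ 2 * m%:R * m%:R by apply: ler_wpM2r.
  have h4 : b * m%:R <= `|b| * m%:R by apply: ler_wpM2r.
  rewrite -natr1 mulrDr mulr1 sqrrD expr1n mul1r exprMn expr2 [m%:R ^+ 2]expr2.
  by rewrite mulrA -expr2; have : 0 <= `|b| by []; lra.
rewrite ler_pXn2r ?nnegrE ?expR_ge1Dx// ?ltW ?expR_gt0//.
by rewrite addr_gt0// mulr_gt0// ltr0n (leq_trans _ mm1).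
Qed.

Lemma pow2_large e b : 0 < e -> exists m0, forall m, (m0 <= m)%N ->
  b <= pow2 (e * m%:R).
Proof.
move=> e0; have [m0 h] := pow2_lin `|b| e0; exists m0 => m /h; apply: le_trans.
by rewrite (le_trans (ler_norm b))// ler_peMr// ler1n.
Qed.

Lemma pow2_small e : 0 < e -> exists m0, forall m, (m0 <= m)%N ->
  pow2 (- m%:R) <= e.
Proof.
move=> e0; have [m0 h] := pow2_large e^-1 ltr01; exists m0 => m /h.
by rewrite mul1r pow2N -[X in _ -> _ <= X]invrK lef_pV2// posrE ?pow2_gt0 ?invr_gt0.
Qed.

(** The dyadic scale [m] of a positive radius [r]: either [m = 0], or
    [2^-m <= r < 2^(1-m)]. *)
Lemma scaleP r : 0 < r :> R -> exists m, pow2 (- m%:R) <= r /\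
  forall n, (n < m)%N -> r < pow2 (- n%:R).
Proof.
move=> r0; have ex : exists m, pow2 (- m%:R) <= r.
  by have [m h] := pow2_small r0; exists m; exact: h.
case: (ex_minnP ex) => m hm min; exists m; split=> // n nm.
by rewrite ltNge; apply/negP => /min; rewrite leqNgt nm.
Qed.

Lemma scale_lt r m : (forall n, (n < m)%N -> r < pow2 (- n%:R)) -> (0 < m)%N ->
  r < pow2 (1 - m%:R).
Proof.
move=> h m0; have := h m.-1; rewrite prednK// => /(_ (leqnn _)).
by rewrite -[in pow2 (1 - m%:R)](prednK m0) -natr1 opprD addrCA subrr addr0.
Qed.

End pow2.

(** * The mass of cylinders *)

Section mass.
Variable R : realType.
Implicit Types (x z : nat -> bool) (n l : nat).

(** The mass of the intersection of two cylinders, for the measure that gives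
    mass [2^-l] to every cylinder of length [l]. *)
Definition mass x n z l : R :=
  if agree (minn n l) x z then pow2 (- (maxn n l)%:R : R) else 0.

Lemma mass_ge0 x n z l : 0 <= mass x n z l.
Proof. by rewrite /mass; case: ifP => // _; exact: pow2_ge0. Qed.

Lemma mass_le x n z l : mass x n z l <= pow2 (- n%:R : R).
Proof.
rewrite /mass; case: ifP => _; last exact: pow2_ge0.
by rewrite pow2_le lerN2 ler_nat leq_maxl.
Qed.

Lemma mass_split x n z l : mass x n z l =
  mass x n (graft z l [:: false]) l.+1 + mass x n (graft z l [:: true]) l.+1.
Proof.
have gl b : agree l (graft z l [:: b]) z := graft_agree _ _ _.
have xgl k b : (k <= l)%N -> agree k x (graft z l [:: b]) = agree k x z.
  move=> kl; apply/idP/idP => /agree_trans; apply; apply: agree_le kl _ => //.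
  by rewrite agree_sym.
rewrite /mass; case: (leqP n l) => nl.
  rewrite (minn_idPl _) 1?leqW// !xgl// (maxn_idPr _) 1?leqW//.
  by case: ifP => _; rewrite ?pow2_half ?addr0.
rewrite (minn_idPr nl) (maxn_idPl nl) !agreeS !xgl//.
have glE b : graft z l [:: b] l = b by rewrite /graft ltnn subnn.
rewrite !glE; case: (agree l x z) => /=; last by rewrite addr0.
by case: (x l) => /=; rewrite ?addr0 ?add0r.
Qed.

(** Kraft's inequality: pairwise disjoint cylinders have total mass at most 1. *)
Lemma kraft (I : eqType) (s : seq I) (x : I -> nat -> bool) (n : I -> nat) :
  uniq s ->
  (forall i j y, i \in s -> j \in s -> agree (n i) (x i) y ->
    agree (n j) (x j) y -> i = j) ->
  \sum_(i <- s) pow2 (- (n i)%:R : R) <= 1.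
Proof.
move=> us disj.
(* The cylinders meet any cylinder of length l in total mass at most 2^-l.  This
   is clear when l exceeds all their lengths, for then at most one of them
   contains the cylinder of length l; the other cases follow by descending
   induction on l, with d a bound for the distance to the longest length. *)
suff main d z l : (forall i, i \in s -> (n i <= l + d)%N) ->
    \sum_(i <- s) mass (x i) (n i) z l <= pow2 (- l%:R : R).
  have -> : \sum_(i <- s) pow2 (- (n i)%:R : R) =
      \sum_(i <- s) mass (x i) (n i) (x i) 0.
    by apply: eq_bigr => i _; rewrite /mass maxn0 agree_refl.
  have -> : \sum_(i <- s) mass (x i) (n i) (x i) 0 =
      \sum_(i <- s) mass (x i) (n i) xpredT 0.
    by apply: eq_bigr => i _; rewrite /mass minn0 /agree.
  apply: le_trans (main (\max_(i <- s) n i) _ 0%N _) _.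
    by move=> i si; rewrite add0n; exact: leq_bigmax_seq.
  by rewrite oppr0 pow2_0.
elim: d z l => [|d ih] z l hn.
  have [/hasP[i si az]|/hasPn no] := boolP (has (fun i => agree (n i) (x i) z) s).
    rewrite (bigD1_seq i)//= big1_seq ?addr0; last first.
      move=> j /andP[ji sj]; rewrite /mass (minn_idPl _); last first.
        by have := hn _ sj; rewrite addn0.
      case: ifP => // jz; case/eqP : ji; exact: disj jz az.
    rewrite /mass; case: ifP => _; last exact: pow2_ge0.
    by rewrite pow2_le lerN2 ler_nat leq_maxr.
  rewrite big1_seq ?pow2_ge0// => i /andP[_ si].
  rewrite /mass (minn_idPl _) ?(negbTE (no _ si))//.
  by have := hn _ si; rewrite addn0.
under eq_bigr do rewrite mass_split.
rewrite big_split/= -pow2_half lerD// ih// => i si.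
  by rewrite addSnnS; exact: hn.
by rewrite addSnnS; exact: hn.
Qed.

(** Nested cylinders have a common point: if every cylinder with property [P j]
    contains a strictly smaller one with property [P j.+1], then some point lies
    in a sequence of cylinders that have these properties in turn. *)
Lemma nested (P : nat -> (nat -> bool) * nat -> Prop) p0 :
  (forall j p, P j p -> exists q, [/\ P j.+1 q, agree p.2 p.1 q.1 & (p.2 < q.2)%N]) ->
  P 0%N p0 ->
  exists y, agree p0.2 p0.1 y /\
    forall j, exists p, [/\ P j p, agree p.2 p.1 y & (j <= p.2)%N].
Proof.
move=> step P0.
pose T := {jp : nat * ((nat -> bool) * nat) | P jp.1 jp.2}.
pose next (a b : T) := [/\ (sval b).1 = (sval a).1.+1,
  agree (sval a).2.2 (sval a).2.1 (sval b).2.1 & ((sval a).2.2 < (sval b).2.2)%N].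
have [f [f0 fS]] : {f : nat -> T | f 0%N = exist _ (0%N, p0) P0 /\
    forall n, next (f n) (f n.+1)}.
  apply: dependent_choice => -[[j p] Pj]; apply: cid.
  have [q [Pq pq lq]] := step _ _ Pj.
  by exists (exist _ (j.+1, q) Pq).
pose g i := (sval (f i)).2.
have gi i : (i <= (g i).2)%N.
  by elim: i => // i ih; have [_ _ h] := fS i; exact: leq_ltn_trans ih h.
have gP i : P i (g i).
  suff e : (sval (f i)).1 = i by have := proj2_sig (f i); rewrite /= e.
  by elim: i => [|i ih]; [rewrite f0|have [-> _ _] := fS i; rewrite ih].
have gle i j : (i <= j)%N -> ((g i).2 <= (g j).2)%N.
  move=> ij; apply: (homo_leq (f := fun i => (g i).2) (r := leq)) ij => //.
    exact: leq_trans.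
  by move=> k; have [_ _ /ltnW] := fS k.
have gag i j : (i <= j)%N -> agree (g i).2 (g i).1 (g j).1.
  elim: j => [|j ih]; first by rewrite leqn0 => /eqP ->; exact: agree_refl.
  rewrite leq_eqVlt => /orP[/eqP ->|ij]; first exact: agree_refl.
  apply: agree_trans (ih ij) _; have [_ h _] := fS j.
  by apply: agree_le h; exact: gle.
pose y i := (g i.+1).1 i.
have gy i : agree (g i).2 (g i).1 y.
  apply/agreeP => k ki; rewrite /y; case: (leqP i k.+1) => ik.
    by have /agreeP -> := gag _ _ ik.
  by have /agreeP -> // := gag _ _ (ltnW ik); exact: gi.
exists y; split; first by have := gy 0%N; rewrite /g f0.
by move=> j; exists (g j).
Qed.

Local Open Scope ereal_scope.

(** Cylinders whose total mass is less than that of a given cylinder do not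
    cover it: one of its two halves has again more mass than they have in it,
    and so on down to a point. *)
Lemma mass_cover (x : nat -> nat -> bool) (n : nat -> nat) z l :
  \sum_(0 <= i <oo) (pow2 (- (n i)%:R : R))%:E < (pow2 (- l%:R : R))%:E ->
  exists y, agree l z y /\ forall i, ~~ agree (n i) (x i) y.
Proof.
move=> lt.
pose tot z l := \sum_(0 <= i <oo) (mass (x i) (n i) z l)%:E.
pose P (j : nat) (p : (nat -> bool) * nat) :=
  p.2 = (l + j)%N /\ tot p.1 p.2 < (pow2 (- p.2%:R : R))%:E.
have tot_split z' l' : tot z' l' =
    tot (graft z' l' [:: false]) l'.+1 + tot (graft z' l' [:: true]) l'.+1.
  rewrite /tot -nneseriesD; first last.
  - by move=> i _ _; rewrite lee_fin mass_ge0.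
  - by move=> i _ _; rewrite lee_fin mass_ge0.
  by apply: eq_eseriesr => i _; rewrite -EFinD -mass_split.
have step j p : P j p ->
    exists q, [/\ P j.+1 q, agree p.2 p.1 q.1 & (p.2 < q.2)%N].
  case: p => z' l' [/= e]; rewrite tot_split -pow2_half EFinD => lt'.
  have [h|h] := ltP (tot (graft z' l' [:: false]) l'.+1) (pow2 (- l'.+1%:R : R))%:E.
    exists (graft z' l' [:: false], l'.+1); split=> //=.
      by split=> //=; rewrite e addnS.
    by rewrite agree_sym graft_agree.
  exists (graft z' l' [:: true], l'.+1); split=> //=.
    split=> /=; first by rewrite e addnS.
    rewrite ltNge; apply/negP => h'; move: lt'; rewrite ltNge => /negP; apply.
    exact: leeD.
  by rewrite agree_sym graft_agree.
have P0 : P 0%N (z, l).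
  split=> /=; first by rewrite addn0.
  apply: le_lt_trans lt; apply: lee_nneseries => [i _ _|i _]; rewrite lee_fin.
    exact: mass_ge0.
  exact: mass_le.
have [y [zy yP]] := nested step P0; exists y; split=> // i; apply/negP => iy.
have [[z' l'] [/= [/= e]]] := yP (n i); rewrite ltNge => /negP + ay _; apply.
have nl : (n i <= l')%N by rewrite e leq_addl.
have -> : (pow2 (- l'%:R : R))%:E = (mass (x i) (n i) z' l')%:E.
  rewrite /mass (minn_idPl nl) (maxn_idPr nl).
  by rewrite (agree_trans iy)// agree_sym (agree_le nl).
pose f i := (mass (x i) (n i) z' l')%:E; rewrite -/(f i).
apply: le_trans (@nneseries_lim_ge _ f xpredT 0 i.+1 _).
  rewrite big_nat_recr//= leeDr// sume_ge0// => k _.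
  by rewrite lee_fin mass_ge0.
by move=> k _ _; rewrite lee_fin mass_ge0.
Qed.

End mass.

(** * The ultrametric space of a profile *)

Section dist.
Variables (R : realType) (M : profile).
Implicit Types (x y z : nat -> bool) (m : nat) (r : R).

(** The distance of distinct points is [2^-m] for the largest [m] such that
    [close M m x y]. *)
Definition dist x y : R :=
  if pselect (exists m, ~~ close M m.+1 x y) is left h
  then pow2 (- (ex_minn h)%:R) else 0.

Lemma dist_val x y : dist x y = 0 \/ exists m, dist x y = pow2 (- m%:R).
Proof.
rewrite /dist; case: pselect => [h|_]; last by left.
by right; exists (ex_minn h).
Qed.

Lemma dist_ge0 x y : 0 <= dist x y.
Proof. by have [->//|[m ->]] := dist_val x y; exact: pow2_ge0. Qed.

Lemma dist_close m x y : (dist x y <= pow2 (- m%:R)) = close M m x y.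
Proof.
rewrite /dist; case: pselect => [h|h].
  case: ex_minnP => j jn jmin; rewrite pow2_le lerN2 ler_nat.
  apply/idP/idP => [mj|mxy].
    case: m mj => [_|m mj]; first exact: close0.
    by apply: contraT => /jmin; rewrite leqNgt mj.
  rewrite leqNgt; apply/negP => jm; case/negP: jn.
  exact: close_le jm mxy.
rewrite pow2_ge0; symmetry; case: m => [|m]; first exact: close0.
by apply: contra_notT h => mxy; exists m.
Qed.

Lemma dist_far m x y : ~~ close M m.+1 x y -> pow2 (- m%:R) <= dist x y.
Proof.
rewrite -dist_close; have [->|[j ->]] := dist_val x y; first by rewrite pow2_ge0.
by rewrite !pow2_le !lerN2 !ler_nat -ltnNge.
Qed.

Lemma dist_le x y x' y' :
  (forall m, close M m x y -> close M m x' y') -> dist x' y' <= dist x y.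
Proof.
move=> h; have [e|[m e]] := dist_val x y; last first.
  by rewrite e dist_close h// -dist_close e.
rewrite e leNgt; apply/negP => /pow2_small[m /(_ _ (leqnn m))].
have [e'|[j e']] := dist_val x' y'; rewrite e'.
  by rewrite leNgt pow2_gt0.
have : dist x' y' <= pow2 (- j.+1%:R).
  by rewrite dist_close h// -dist_close e pow2_ge0.
by rewrite e' pow2_le lerN2 ler_nat ltnn.
Qed.

Lemma distxx x : dist x x = 0.
Proof.
apply/eqP; rewrite eq_le dist_ge0 andbT leNgt; apply/negP.
have [->|[j e]] := dist_val x x; first by rewrite ltxx.
have : dist x x <= pow2 (- j.+1%:R) by rewrite dist_close close_refl.
by rewrite e pow2_le lerN2 ler_nat ltnn.
Qed.

Lemma dist_positivity x y : dist x y = 0 -> x = y.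
Proof.
by move=> e; apply: (@close_eq M) => m; rewrite -dist_close e pow2_ge0.
Qed.

Lemma dist_sym x y : dist x y = dist y x.
Proof.
by apply/eqP; rewrite eq_le !dist_le// => m; rewrite close_sym.
Qed.

Lemma dist_ultra x y z : dist x y <= Num.max (dist x z) (dist z y).
Proof.
rewrite le_max; case: (leP (dist z y) (dist x z)) => [h|/ltW h].
  apply/orP; left; apply: dist_le => m xz; apply: close_trans (xz) _.
  by rewrite -dist_close (le_trans h)// dist_close.
apply/orP; right; apply: dist_le => m zy; apply: close_trans (zy).
by rewrite -dist_close (le_trans h)// dist_close.
Qed.

Lemma dist_triangle z x y : dist x y <= dist x z + dist z y.
Proof.
by rewrite (le_trans (dist_ultra x y z))// ge_max lerDl lerDr !dist_ge0.
Qed.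

End dist.

(** The set of binary sequences with the ultrametric of the profile [M]. *)
Definition pspace (R : realType) (M : profile) : Type := nat -> bool.

HB.instance Definition _ (R : realType) (M : profile) :=
  Choice.copy (pspace R M) (nat -> bool).

HB.instance Definition _ (R : realType) (M : profile) :=
  @isMetric.Build R (pspace R M) (@dist R M) (@distxx R M)
    (@dist_positivity R M) (@dist_sym R M) (@dist_triangle R M).

Section pspace.
Variables (R : realType) (M : profile).
Let X : metricType R := pspace R M.
Implicit Types (x y z : X) (m : nat) (r : R).

Lemma mdistE x y : mdist x y = dist R M x y.
Proof. by []. Qed.

Lemma pspace_ultrametric : ultrametric X.
Proof. by move=> x y z; rewrite !mdistE; exact: dist_ultra. Qed.

Lemma cball_pow2 x m : cball x (pow2 (- m%:R)) = [set y | close M m x y].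
Proof. by apply/seteqP; split => y; rewrite /cball/= mdistE dist_close. Qed.

(** A ball is determined by the dyadic scale of its radius. *)
Lemma cball_scale x r m : pow2 (- m%:R) <= r ->
  (forall n, (n < m)%N -> r < pow2 (- n%:R)) ->
  cball x r = [set y | close M m x y].
Proof.
move=> mr rm; apply/seteqP; split => y; rewrite /cball/= mdistE; last first.
  by rewrite -(dist_close R) => /le_trans; exact.
move=> xyr; case: m mr rm => [|m] mr rm; first exact: close0.
have xym : dist R M x y < pow2 (- m%:R) by rewrite (le_lt_trans xyr) ?rm.
rewrite -(dist_close R); have [e|[j e]] := dist_val R M x y.
  by rewrite e pow2_ge0.
by move: xym; rewrite e pow2_lt pow2_le !ltrN2 !lerN2 ltr_nat ler_nat.
Qed.

(** The identity is a homeomorphism: the metric induces the product topology. *)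
Lemma pspace_homeomorphic : homeomorphic X cantor_space.
Proof.
exists (fun x => x), (fun x => x); split=> // x.
  have ff : Filter ((fun y : X => (y : nat -> bool)) @ nbhs x).
    exact: fmap_filter.
  apply: (@pointwise_cvgP nat bool _ x ff).2 => i V /= Vxi.
  have {}Vxi : V (x i) := nbhs_singleton Vxi.
  have [m im] := cut_unbounded M x i.+1.
  apply/nbhs_ballP; exists (pow2 (- m%:R)); first exact: pow2_gt0.
  move=> y; rewrite ballEmdist/= mdistE => /ltW; rewrite dist_close => xy.
  by have /agreeP <- := xy.
move=> V /nbhs_ballP[e /= e0 eV].
have [m [me _]] := scaleP (e0 : 0 < e).
have : \forall y \near (x : cantor_space), agree (cut M x m.+1) x y.
  elim: (cut M x m.+1) => [|n ih]; first by apply: filterE => y; exact/agreeP.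
  have : \forall y \near (x : cantor_space), y n = x n.
    exact: (@proj_continuous nat (fun=> bool) n x [set x n] (discrete_set1 _)).
  by move: ih; apply: filterS2 => y xy yn; rewrite agreeS xy yn eqxx.
apply: filterS => y xy; apply: eV; rewrite ballEmdist/= mdistE.
rewrite (@le_lt_trans _ _ (pow2 (- m.+1%:R)))//; first by rewrite dist_close.
by rewrite (lt_le_trans _ me)// pow2_lt ltrN2 ltr_nat.
Qed.

End pspace.

(** * Box and Assouad dimensions *)

(** A version of [pow2_lin] for all [m], with a constant factor. *)
Lemma pow2_lin_uniform (R : realType) (e b : R) : 0 < e ->
  exists2 K, 0 < K & forall m, b * m.+1%:R <= K * pow2 (e * m%:R).
Proof.
move=> e0; have [m0 h] := pow2_lin `|b| e0.
exists (1 + `|b| * m0.+1%:R) => [|m].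
  by rewrite ltr_pwDl// mulr_ge0.
have p1 : 1 <= pow2 (e * m%:R).
  by rewrite pow2_ge1 mulr_ge0// ltW.
have bm : b * m.+1%:R <= `|b| * m.+1%:R by rewrite ler_wpM2r// ler_norm.
apply: (le_trans bm); rewrite mulrDl mul1r.
case: (leqP m0 m) => mm.
  by rewrite (le_trans (h m mm))// lerDl mulr_ge0// ?pow2_ge0// mulr_ge0.
rewrite (@le_trans _ _ (`|b| * m0.+1%:R * pow2 (e * m%:R)))//; last first.
  by rewrite lerDr pow2_ge0.
rewrite (@le_trans _ _ (`|b| * m0.+1%:R))//.
  by rewrite ler_wpM2l// ler_nat ltnS ltnW.
by rewrite ler_peMr// mulr_ge0.
Qed.

Section covering.
Variables (R : realType) (M : profile).
Let X : metricType R := pspace R M.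
Implicit Types (x y z : X) (k m n : nat) (r s : R).
Local Open Scope ereal_scope.

Lemma covering_number_ge0 (A : set X) r : 0 <= covering_number A r.
Proof. by apply: le_ereal_inf_tmp => _ [E _ <-]; rewrite lee_fin. Qed.

Lemma close_net_real x m n b : (m <= n)%N ->
  (forall k, (M k n)%:R - (M k m)%:R <= b)%R ->
  exists s : seq X, [/\ ((size s)%:R <= (n - m).+1%:R * pow2 b :> R)%R,
    forall y, y \in s -> close M m x y &
    forall y, close M m x y -> exists2 z, z \in s & close M n z y].
Proof.
move=> mn hb; pose D := Num.trunc b.
have b0 : (0 <= b)%R.
  by apply: le_trans (hb n); rewrite subr_ge0 ler_nat prof_le.
have hD k : (M k n - M k m <= D)%N.
  by rewrite truncn_ge_nat// natrB ?prof_le.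
have [s [szs sub cov]] := @close_net M x m n D mn hD.
exists s; split=> //.
rewrite (@le_trans _ _ ((n - m + 1) * 2 ^ D)%:R)%R// ?ler_nat// natrM addn1.
by rewrite ler_wpM2l// -pow2_nat pow2_le truncn_le.
Qed.

Lemma covering_number_le x m n r b : (m <= n)%N -> (pow2 (- n%:R) <= r)%R ->
  (forall k, (M k n)%:R - (M k m)%:R <= b)%R ->
  covering_number ([set y | close M m x y] : set X) r <=
    ((n - m).+1%:R * pow2 b)%:E.
Proof.
move=> mn nr /(close_net_real x mn)[s [szs sub cov]].
apply: (@le_trans _ _ (#|` [fset y in s]%fset|%:R)%:E).
  apply: ereal_inf_lbound; exists [fset y in s]%fset => //; split.
    by move=> y /=; rewrite inE/= => /sub.
  move=> y /cov[z zs zy]; exists z; first by rewrite /= inE.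
  rewrite /cball/= (le_trans _ nr)//.
  by have : [set y | close M n z y] y by []; rewrite -(@cball_pow2 R).
rewrite lee_fin (@le_trans _ _ (size s)%:R)//.
by rewrite ler_nat card_fseq; exact: size_undup.
Qed.

Lemma covering_number_ge (A : set X) x k m n : (k < m)%N -> (m <= n)%N ->
  (forall i, (i < k)%N -> x i) -> x k = false ->
  [set y | close M m x y] `<=` A ->
  (pow2 ((M k n)%:R - (M k m)%:R))%:E <= covering_number A (pow2 (- n%:R)).
Proof.
move=> km mn xt xf mA; apply: le_ereal_inf_tmp => _ [E [EA AE] <-].
rewrite lee_fin -natrB ?prof_le// pow2_nat ler_nat.
apply: (@net_size_ge M x m n k (enum_fset E) km mn xt xf) => y /mA /AE[z zE].
by rewrite cball_pow2 => zy; exists z.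
Qed.

(** A point of the [k]-th piece, the set of the sequences whose first entry
    [false] is at position [k]. *)
Definition piece_pt k : X := fun i => (i < k)%N.

Lemma piece_pt_false k : piece_pt k k = false. Proof. exact: ltnn. Qed.

Lemma setT_close : [set: X] = [set y | close M 0 (piece_pt 0) y].
Proof. by apply/seteqP; split => // y _; exact: close0. Qed.

Lemma box_dim_le s : (exists b, forall k m, (M k m)%:R <= s * m%:R + b)%R ->
  upper_box_dim X <= s%:E.
Proof.
move=> [b hb]; apply/lee_addgt0Pr => e e0.
have [m0 hm0] := pow2_lin (pow2 (b + (s + e)))%R e0.
apply: ge_ereal_inf; exists (ereal_sup [set lne (covering_number [set: X] r) /
   (- ln r)%:E | r in [set r | 0 < r < pow2 (- (maxn m0 1)%:R)]%R]).
  exists [set r | 0 < r < pow2 (- (maxn m0 1)%:R)]%R => //.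
  exists (pow2 (- (maxn m0 1)%:R)); first exact: pow2_gt0.
  by move=> r /=; rewrite sub0r normrN => + r0; rewrite gtr0_norm// r0.
apply: ge_ereal_sup => _ [r /= /andP[r0 rm] <-].
have [n [nr rn]] := scaleP r0.
have nm : (maxn m0 1 < n)%N.
  rewrite ltnNge; apply/negP => nm.
  by move: (le_lt_trans nr rm); rewrite pow2_lt ltrN2 ltr_nat ltnNge nm.
move: nm; rewrite gtn_max => /andP[m0n n1].
have n0 : (0 < n)%N by exact: ltn_trans n1.
have rn1 := scale_lt rn n0.
have lnr : ((n%:R - 1) * ln 2 <= - ln r)%R.
  rewrite lerNr -mulNr opprB -ln_pow2 ler_ln ?posrE ?pow2_gt0//.
  exact: ltW.
have ln2 : (0 < ln 2 :> R)%R by rewrite ln_gt0// ltr1n.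
have n10 : (0 < n%:R - 1 :> R)%R by rewrite subr_gt0 ltr1n.
have lnr0 : (0 < - ln r)%R by rewrite (lt_le_trans _ lnr)// mulr_gt0.
have se0 : (0 <= s + e)%R.
  (* Otherwise s * m + b would eventually be negative, and M 0 m is not. *)
  rewrite leNgt; apply/negP => se.
  have s0 : (0 < - s)%R by lra.
  have [m1 hm1] := pow2_large (pow2 b + 1)%R s0.
  have := hm1 m1 (leqnn _); rewrite leNgt => /negP; apply.
  rewrite (@le_lt_trans _ _ (pow2 b))%R ?ltrDl// pow2_le.
  have := hb 0%N m1; have : (0 <= (M 0 m1)%:R :> R)%R by [].
  lra.
have Nle : covering_number [set: X] r <= (pow2 ((s + e) * (n%:R - 1)))%:E.
  rewrite setT_close.
  apply: le_trans (@covering_number_le _ 0 n r (s * n%:R + b)%R _ nr _) _ => //.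
    by move=> k; rewrite (prof0 M (leq0n k)) subr0.
  rewrite subn0 lee_fin.
  have := hm0 n (ltnW m0n).
  have -> : ((s + e) * (n%:R - 1) = e * n%:R + (s * n%:R + b - (b + (s + e))))%R.
    by ring.
  rewrite (pow2D (e * n%:R)) (pow2D (s * n%:R + b)) pow2N => h.
  rewrite mulrA [leRHS]mulrAC ler_wpM2r ?pow2_ge0// ler_pdivlMr ?pow2_gt0//.
  by rewrite mulrC.
rewrite inver gt_eqF// lee_pdivrMr//.
apply: (@le_trans _ _ ((s + e) * ((n%:R - 1) * ln 2))%:E); last first.
  by rewrite -EFinM lee_fin ler_wpM2l.
rewrite mulrA -ln_pow2 -lne_EFin ?pow2_gt0// lee_lne//.
  by rewrite in_itv/= covering_number_ge0 leey.
by rewrite in_itv/= lee_fin pow2_ge0 leey.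
Qed.

(** The balls of radius [2^-n] are counted inside a ball of radius [2^-(k+1)],
    which is contained in the [k]-th piece. *)
Lemma box_dim_ge s : (forall N, exists k n, [/\ (N <= n)%N, (k < n)%N &
    (s * n%:R <= (M k n)%:R - (M k k.+1)%:R)%R]) ->
  s%:E <= upper_box_dim X.
Proof.
move=> h; apply: le_ereal_inf_tmp => _ [V [e /= e0 eV] <-].
have [m0 hm0] := pow2_small (e0 : 0 < e)%R.
have [k [n [Nn kn sn]]] := h m0.+1.
have n0 : (0 < n)%N by exact: leq_ltn_trans kn.
apply: le_ereal_sup_tmp.
exists (lne (covering_number [set: X] (pow2 (- n%:R))) / (- ln (pow2 (- n%:R)))%:E).
  exists (pow2 (- n%:R)) => //; apply: eV; last exact: pow2_gt0.
  rewrite /= sub0r normrN gtr0_norm ?pow2_gt0//.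
  by rewrite (lt_le_trans _ (hm0 m0 _))// pow2_lt ltrN2 ltr_nat.
have ln2 : (0 < ln 2 :> R)%R by rewrite ln_gt0// ltr1n.
have nln2 : (0 < n%:R * ln 2 :> R)%R by rewrite mulr_gt0 ?ltr0n.
rewrite ln_pow2 mulNr opprK inver gt_eqF// lee_pdivlMr//.
rewrite -EFinM mulrA.
apply: (@le_trans _ _ (lne (pow2 (s * n%:R))%:E)).
  by rewrite lne_EFin ?pow2_gt0// ln_pow2.
rewrite lee_lne//.
- apply: le_trans (@covering_number_ge _ (piece_pt k) k k.+1 n _ _ _ _ _) => //.
  + by rewrite lee_fin pow2_le.
  + exact: piece_pt_false.
- by rewrite in_itv/= lee_fin pow2_ge0 leey.
- by rewrite in_itv/= covering_number_ge0 leey.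
Qed.

Lemma assouad_dim_le s : (0 <= s)%R ->
  (exists b, forall k m n, (m <= n)%N ->
    (M k n)%:R - (M k m)%:R <= s * (n%:R - m%:R) + b)%R ->
  assouad_dim X <= s%:E.
Proof.
move=> s0 [b hb]; apply/lee_addgt0Pr => e e0.
have [K K0 hK] := pow2_lin_uniform (pow2 (b + (s + e))) e0.
apply: ereal_inf_lbound; exists (s + e)%R => //; split; first exact: ltr_wpDl.
exists K; split=> // x r1 r2 r20 r21.
have r10 : (0 < r1)%R := lt_trans r20 r21.
have [m [mr1 r1m]] := scaleP r10; have [n [nr2 r2n]] := scaleP r20.
have mn : (m <= n)%N.
  rewrite leqNgt; apply/negP => /r1m; rewrite ltNge => /negP; apply.
  exact: ltW (le_lt_trans nr2 r21).
have ratio : (pow2 (n%:R - m%:R - 1) <= r1 / r2)%R.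
  rewrite ler_pdivlMr//; case: (posnP n) => [n0|n0].
    move: mn; rewrite n0 leqn0 => /eqP ->; rewrite subrr sub0r.
    rewrite (@le_trans _ _ r2)//; last exact: ltW.
    rewrite ger_pMl// pow2_le1; lra.
  have rn1 := scale_lt r2n n0.
  apply: le_trans mr1.
  rewrite (@le_trans _ _ (pow2 (n%:R - m%:R - 1) * pow2 (1 - n%:R))%R)//.
    by rewrite ler_wpM2l ?pow2_ge0// ltW.
  by rewrite -pow2D pow2_le; lra.
rewrite (cball_scale _ mr1 r1m).
have hcov := @covering_number_le x m n r2 _ mn nr2 (fun k => hb k m n mn).
apply: (le_trans hcov).
rewrite lee_fin.
apply: (@le_trans _ _ (K * pow2 (n%:R - m%:R - 1) `^ (s + e)))%R; last first.
  rewrite ler_wpM2l ?(ltW K0)// ge0_ler_powR ?nnegrE ?pow2_ge0//.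
    by rewrite addr_ge0// ltW.
  by rewrite divr_ge0// ltW.
rewrite powR_pow2; have := hK (n - m)%N; rewrite natrB//.
set d : R := (n%:R - m%:R)%R => h.
have -> : ((d - 1) * (s + e) = e * d + (s * d + b - (b + (s + e))))%R by ring.
rewrite (pow2D (e * d)) (pow2D (s * d + b)) pow2N.
rewrite !mulrA [leRHS]mulrAC ler_wpM2r ?pow2_ge0// ler_pdivlMr ?pow2_gt0//.
by rewrite mulrC.
Qed.

Lemma assouad_dim_ge s : (forall b : R, exists k m n, [/\ (k < m)%N, (m < n)%N &
    (s * (n%:R - m%:R) + b <= (M k n)%:R - (M k m)%:R)%R]) ->
  s%:E <= assouad_dim X.
Proof.
move=> h; apply: le_ereal_inf_tmp => _ [l [l0 [C [C0 hC]]] <-].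
rewrite lee_fin leNgt; apply/negP => ls.
have [b hb] := pow2_large (C + 1)%R (@ltr01 R).
have {}hb := hb b (leqnn b); rewrite mul1r in hb.
have [k [m [n [km mn sn]]]] := h b%:R%R.
have nm : (pow2 (- n%:R) < pow2 (- m%:R) :> R)%R by rewrite pow2_lt ltrN2 ltr_nat.
have := hC (piece_pt k) _ _ (pow2_gt0 (- n%:R)) nm.
apply/negP; rewrite -ltNge.
apply: lt_le_trans (@covering_number_ge _ (piece_pt k) k m n km (ltnW mn) _ _ _) => //.
- rewrite lte_fin (@lt_le_trans _ _ (pow2 (s * (n%:R - m%:R) + b%:R)))%R ?pow2_le//.
  rewrite -pow2N -pow2D opprK powR_pow2 pow2D mulrC.
  apply: (@lt_le_trans _ _ (pow2 (s * (n%:R - m%:R)) * C))%R; last first.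
    by rewrite ler_wpM2l ?pow2_ge0//; lra.
  rewrite ltr_pM2r// pow2_lt [(- _ + _)%R]addrC mulrC ltr_pM2r//.
  by rewrite subr_gt0 ltr_nat.
- exact: piece_pt_false.
- by rewrite cball_pow2.
Qed.

End covering.

(** * Hausdorff dimension *)

Section hausdorff.
Variables (R : realType) (M : profile).
Let X : metricType R := pspace R M.
Implicit Types (x y z : X) (k m n : nat) (r s t : R) (A : set X).
Local Open Scope ereal_scope.

Lemma mdist_diam A x y : A x -> A y -> (mdist x y)%:E <= diam A.
Proof.
move=> Ax Ay; rewrite /diam le_max; apply/orP; right.
by apply: ereal_sup_ubound; exists x => //; exists y.
Qed.

Lemma diam_le A r : (0 <= r)%R -> (forall x y, A x -> A y -> mdist x y <= r)%R ->
  diam A <= r%:E.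
Proof.
move=> r0 h; rewrite /diam ge_max lee_fin r0/=.
by apply: ge_ereal_sup => _ [x Ax [y Ay <-]]; rewrite lee_fin h.
Qed.

Lemma diam_pow_ge0 t A : 0 <= diam_pow t A.
Proof. by rewrite /diam_pow; case: ifP => // _; exact: poweR_ge0. Qed.

Lemma diam_ge0 A : 0 <= diam A.
Proof. by rewrite /diam le_max lexx. Qed.

Lemma diam_pow_le t A r : (0 <= t)%R -> (0 <= r)%R -> diam A <= r%:E ->
  diam_pow t A <= (r `^ t)%:E.
Proof.
move=> t0 r0 Ar; rewrite /diam_pow; case: ifP => _.
  by rewrite lee_fin powR_ge0.
rewrite -poweR_EFin gt0_ler_poweR// in_itv/= leey andbT ?diam_ge0//.
Qed.

Lemma diam_close z m : diam ([set y | close M m z y] : set X) <= (pow2 (- m%:R))%:E.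
Proof.
apply: diam_le => [|x y /= zx zy]; first exact: pow2_ge0.
by rewrite mdistE dist_close (close_trans _ zy)// close_sym.
Qed.

(** The nets of the whole space at the scales [2^-m] provided by the hypothesis
    yield finite covers with arbitrarily small sums. *)
Lemma hausdorff_dim_le s : (0 <= s)%R ->
  (forall N, exists m, (N <= m)%N /\ forall k, ((M k m)%:R <= s * m%:R)%R) ->
  hausdorff_dim X <= s%:E.
Proof.
move=> s0 h; apply/lee_addgt0Pr => e e0.
apply: ereal_inf_lbound; exists (s + e)%R => //; split.
  by rewrite addr_ge0// ltW.
have se0 : (0 <= s + e)%R by rewrite addr_ge0// ltW.
have series_ge0 (F : nat -> set X) :
    0 <= \sum_(0 <= i <oo) diam_pow (s + e) (F i).
  by apply: nneseries_ge0 => i _ _; exact: diam_pow_ge0.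
apply/eqP; rewrite eq_le; apply/andP; split; last first.
  apply: le_ereal_sup_tmp; exists (hausdorff_premeasure (s + e) 1 [set: X]).
    by exists 1%R => //=.
  by apply: le_ereal_inf_tmp => _ [F _ <-].
apply: ge_ereal_sup => _ [d /= d0 <-].
apply/lee_addgt0Pr => g g0; rewrite add0e.
have [m1 hm1] := pow2_lin (g^-1)%R e0.
have [m2 hm2] := pow2_small (d0 : 0 < d)%R.
have [m [mm hm]] := h (maxn m1 m2.+1).
have [m1m m2m] : (m1 <= m)%N /\ (m2 < m)%N by move: mm; rewrite geq_max => /andP.
have hm0 k : ((M k m)%:R - (M k 0)%:R <= s * m%:R)%R.
  by rewrite (prof0 M (leq0n k)) subr0.
have [l [szl _ cov]] := close_net_real (piece_pt R M 0) (leq0n m) hm0.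
pose F i : set X := if (i < size l)%N
  then [set y | close M m (nth (piece_pt R M 0) l i) y] else set0.
apply: (@le_trans _ _ (\sum_(0 <= i <oo) diam_pow (s + e) (F i))).
  apply: ereal_inf_lbound; exists F => //; split.
    move=> y _; have [z zl zy] := cov y (close0 _ _ _).
    by exists (index z l) => //; rewrite /F index_mem zl/= nth_index.
  move=> i; apply: (@le_lt_trans _ _ (pow2 (- m%:R))%:E).
    rewrite /F; case: ifP => _; first exact: diam_close.
    by apply: diam_le => //; exact: pow2_ge0.
  by rewrite lte_fin (lt_le_trans _ (hm2 m2 _))// pow2_lt ltrN2 ltr_nat.
rewrite (@nneseries_split _ _ 0 (size l)); last by move=> k _; exact: diam_pow_ge0.
rewrite eseries0 ?adde0; last first.
  by move=> i; rewrite add0n => li _; rewrite /F ltnNge li/= /diam_pow eqxx.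
apply: (@le_trans _ _ (\sum_(0 <= i < 0 + size l) (pow2 (- m%:R) `^ (s + e))%:E)).
  apply: lee_sum => i _; apply: diam_pow_le => //; first exact: pow2_ge0.
  rewrite /F; case: ifP => _; first exact: diam_close.
  by apply: diam_le => //; exact: pow2_ge0.
rewrite sumEFin lee_fin sumr_const_nat add0n subn0 -[(_ *+ size l)%R]mulr_natl.
rewrite (@le_trans _ _ (m.+1%:R * pow2 (s * m%:R) * pow2 (- m%:R) `^ (s + e)))%R//.
  by rewrite ler_wpM2r ?powR_ge0 -1?[m in m.+1](subn0 m).
rewrite powR_pow2 -mulrA -pow2D.
have -> : (s * m%:R + - m%:R * (s + e) = - (e * m%:R))%R by ring.
rewrite pow2N ler_pdivrMr ?pow2_gt0// -ler_pdivrMl//.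
exact: hm1.
Qed.

(** A set meets the [0]-th piece inside a cylinder whose mass is controlled by
    a power of the diameter of the set; the error [e] takes care of the sets of
    diameter 0. *)
Lemma diam_cylinder t b A e : (0 <= t)%R ->
  (forall m, t * m%:R - b <= (M 0 m)%:R)%R -> (0 < e)%R ->
  exists xn : X * nat, (forall y, A y -> y 0%N = false -> agree xn.2 xn.1 y) /\
    (pow2 (- xn.2%:R))%:E <= (pow2 b)%:E * diam_pow t A + e%:E.
Proof.
move=> t0 hb e0; have [n0 hn0] := pow2_small e0.
have pos : 0 <= (pow2 b)%:E * diam_pow t A.
  by rewrite mule_ge0 ?diam_pow_ge0// lee_fin pow2_ge0.
have small n : (n0 <= n)%N -> (pow2 (- n%:R))%:E <= (pow2 b)%:E * diam_pow t A + e%:E.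
  by move=> nn; rewrite (@le_trans _ _ e%:E) ?lee_fin ?hn0// leeDr.
have [[p [Ap p0]]|no] := pselect (exists p, A p /\ p 0%N = false); last first.
  exists (piece_pt R M 0, n0); split; last exact: small.
  by move=> y Ay y0; case: no; exists y.
have agr m y : y (0%N) = false -> close M m p y -> agree (1 + M 0 m)%N p y.
  case: m => [|m] y0 py.
    by rewrite prof_diag; apply/agreeP => -[|//] _; rewrite p0 y0.
  by rewrite -(@close_piece M p m.+1 0%N).
have [far|near] := pselect (exists m, `[< exists2 q, A q & ~~ close M m p q >]);
  last first.
  have [m hm] := prof_unbounded M 0 n0.
  exists (p, (1 + M 0 m)%N); split => /=; last first.
    by apply: small; rewrite (leq_trans hm)// leq_addl.
  move=> y Ay y0; apply: agr => //; apply: contrapT => /negP py.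
  by apply: near; exists m; apply/asboolP; exists y.
case: (ex_minnP far) => -[|j] /asboolP[q Aq pq] jmin; first by rewrite close0 in pq.
exists (p, (1 + M 0 j)%N); split => /=.
  move=> y Ay y0; apply: agr => //; apply: contrapT => /negP py.
  have /jmin : `[< exists2 q, A q & ~~ close M j p q >] by apply/asboolP; exists y.
  by rewrite ltnn.
rewrite (@le_trans _ _ ((pow2 b)%:E * diam_pow t A))//; last first.
  by rewrite leeDl// lee_fin ltW.
have far' : (pow2 (- j%:R) `^ t)%:E <= diam_pow t A.
  rewrite /diam_pow; case: ifPn => [/eqP A0|_]; first by rewrite A0 in Ap.
  rewrite -poweR_EFin gt0_ler_poweR//.
  - by rewrite in_itv/= leey lee_fin pow2_ge0.
  - by rewrite in_itv/= leey diam_ge0.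
  - by apply: le_trans (mdist_diam Ap Aq); rewrite lee_fin mdistE dist_far.
apply: (@le_trans _ _ ((pow2 b)%:E * (pow2 (- j%:R) `^ t)%:E)); last first.
  by rewrite lee_wpmul2l// lee_fin pow2_ge0.
rewrite -EFinM lee_fin powR_pow2 -pow2D pow2_le natrD.
have := hb j; lra.
Qed.

(** Mass distribution principle on the [0]-th piece. *)
Lemma hausdorff_dim_ge s : (exists b, forall m, s * m%:R - b <= (M 0 m)%:R)%R ->
  s%:E <= hausdorff_dim X.
Proof.
move=> [b hb]; apply: le_ereal_inf_tmp => _ [t [t0 Ht] <-].
rewrite lee_fin leNgt; apply/negP => ts.
have {}hb m : (t * m%:R - b <= (M 0 m)%:R)%R.
  by apply: le_trans (hb m); rewrite lerB// ler_wpM2r// ltW.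
(* A cover with sum less than g yields cylinders of total mass less than
   2^b * g + 1/8 = 3/8, while the 0-th piece is a cylinder of mass 1/2. *)
pose g : R := (pow2 (- b) / 4)%R.
have g0 : (0 < g)%R by rewrite divr_gt0// pow2_gt0.
have : hausdorff_premeasure t 1 [set: X] < g%:E.
  apply: (@le_lt_trans _ _ 0); last by rewrite lte_fin.
  by rewrite -Ht; apply: ereal_sup_ubound; exists 1%R => //=.
move=> /ereal_inf_lt[_ [F [cov _] <-] Fg].
have e0 i : (0 < 8^-1 / (2 ^ i.+1)%:R :> R)%R by rewrite divr_gt0// ltr0n expn_gt0.
have [xn hxn] := choice (fun i => diam_cylinder (F i) t0 hb (e0 i)).
have [] := @mass_cover R (fun i => (xn i).1) (fun i => (xn i).2) (fun=> false) 1.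
  apply: (@le_lt_trans _ _ (\sum_(0 <= i <oo)
      ((pow2 b)%:E * diam_pow t (F i) + (8^-1 / (2 ^ i.+1)%:R)%:E))).
    by apply: lee_nneseries => i _; [rewrite lee_fin pow2_ge0|case: (hxn i)].
  have pos i : 0 <= (pow2 b)%:E * diam_pow t (F i).
    by rewrite mule_ge0 ?diam_pow_ge0// lee_fin pow2_ge0.
  apply: le_lt_trans (epsilon_trick xpredT pos _) _ => //.
  rewrite nneseriesZl; last by move=> i _; exact: diam_pow_ge0.
  apply: (@le_lt_trans _ _ ((pow2 b)%:E * g%:E + 8^-1%:E)).
    by rewrite leeD2r// lee_wpmul2l ?lee_fin ?pow2_ge0// ltW.
  rewrite -EFinM -EFinD lte_fin /g pow2N mulrA divff ?gt_eqF ?pow2_gt0//.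
  have -> : (pow2 (- 1%:R) = 2^-1 :> R)%R by rewrite pow2N pow2_nat.
  by lra.
move=> y [/agreeP/(_ 0%N isT) y0 hy]; have [i _ Fiy] := cov y I.
by have [/(_ y Fiy (esym y0)) + _] := hxn i; apply/negP.
Qed.

End hausdorff.

(** * Packing dimension *)

Lemma esum_le (R : realType) (T : choiceType) (I : set T) (f : T -> R) (b : R) :
  (forall s : seq T, uniq s -> (forall i, i \in s -> I i) ->
    \sum_(i <- s) f i <= b) ->
  (\esum_(i in I) (f i)%:E <= b%:E)%E.
Proof.
move=> h; apply: ge_ereal_sup => _ [A [finA AI] <-].
rewrite fsbig_finite//= sumEFin lee_fin h// => i; rewrite in_fset_set//.
by rewrite inE => /AI.
Qed.

Section packing.
Variables (R : realType) (M : profile).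
Let X : metricType R := pspace R M.
Implicit Types (x y z : X) (k m n : nat) (r s t : R) (A : set X).
Local Open Scope ereal_scope.

Lemma packing_premeasure_ge0 t d A : 0 <= packing_premeasure t d A.
Proof.
apply: le_ereal_sup_tmp; exists 0 => //.
exists set0, (fun=> piece_pt R M 0), (fun=> 1%R); split; last by rewrite esum_set0.
by split=> // i j [].
Qed.

Lemma packing_premeasure0_ge0 t A : 0 <= packing_premeasure0 t A.
Proof.
by apply: le_ereal_inf_tmp => _ [d _ <-]; exact: packing_premeasure_ge0.
Qed.

(** The [k]-th piece of the space. *)
Definition piece k : set X :=
  [set y : nat -> bool | (forall i, (i < k)%N -> y i) /\ y k = false].

(** The balls of a packing of a piece are disjoint cylinders, so that Kraft's
    inequality bounds the sum of their masses. *)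
Lemma packing_piece k s e b d : (0 <= s)%R -> (0 < e)%R ->
  (forall m, (M k m)%:R <= s * m%:R + b)%R -> (0 < d)%R ->
  (d < pow2 (- k%:R))%R ->
  packing_premeasure (s + e) d (piece k) <=
    (pow2 (k.+1%:R + b + s) * d `^ e)%:E.
Proof.
move=> s0 e0 hb d0 dk; apply: ge_ereal_sup => _ [I [c [r [[rI cI dis] ->]]]].
have sc i : exists m, I i -> [/\ (k < m)%N, (pow2 (- m%:R) <= r i)%R,
    (r i < pow2 (1 - m%:R))%R & cball (c i) (r i) = [set y | close M m (c i) y]].
  have [Ii|nI] := pselect (I i); last by exists 0%N.
  have /andP[r0 rd] := rI _ Ii; have [m [mr rm]] := scaleP r0.
  have km : (k < m)%N.
    by have := le_lt_trans mr (lt_trans rd dk); rewrite pow2_lt ltrN2 ltr_nat.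
  exists m => _; split=> //; last exact: cball_scale.
  by apply: scale_lt => //; exact: leq_ltn_trans km.
have [mm hmm] := choice sc.
pose K : R := pow2 (k.+1%:R + b + s).
pose n i := (k.+1 + M k (mm i))%N.
have ri i : I i -> (r i `^ (s + e) <= K * d `^ e * pow2 (- (n i)%:R))%R.
  move=> Ii; have /andP[r0 rd] := rI _ Ii; have [km mr rm _] := hmm i Ii.
  rewrite powRD; last by rewrite (gt_eqF r0) implybT.
  rewrite mulrAC; apply: ler_pM; rewrite ?powR_ge0//; last first.
    by apply: ge0_ler_powR; rewrite ?nnegrE//; exact: ltW.
  apply: (@le_trans _ _ (pow2 (1 - (mm i)%:R) `^ s))%R.
    by apply: ge0_ler_powR; rewrite ?nnegrE ?pow2_ge0//; exact: ltW.
  rewrite powR_pow2 /K -pow2D pow2_le /n natrD.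
  by have := hb (mm i); lra.
apply: esum_le => l ul lI.
rewrite (@le_trans _ _ (\sum_(i <- l) (K * d `^ e * pow2 (- (n i)%:R))))%R//.
  by rewrite big_seq [leRHS]big_seq; apply: ler_sum => i /lI; exact: ri.
rewrite -mulr_sumr ger_pMr ?mulr_gt0 ?pow2_gt0 ?powR_gt0//.
apply: (@kraft R _ l c n ul) => i j y /lI Ii /lI Ij iy jy.
apply: (dis i j Ii Ij); exists y; split.
  have [km _ _ ->] := hmm i Ii; have [ct cf] := cI i Ii.
  by rewrite /= (close_piece M _ km ct cf).
have [km _ _ ->] := hmm j Ij; have [ct cf] := cI j Ij.
by rewrite /= (close_piece M _ km ct cf).
Qed.

Lemma packing_singleton x t d : (0 <= t)%R -> (0 < d)%R ->
  packing_premeasure t d [set x] <= (d `^ t)%:E.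
Proof.
move=> t0 d0; apply: ge_ereal_sup => _ [I [c [r [[rI cI dis] ->]]]].
apply: esum_le => -[|i [|j l]] ul lI.
- by rewrite big_nil powR_ge0.
- rewrite big_seq1; have /andP[r0 rd] := rI i (lI i (mem_head _ _)).
  by apply: ge0_ler_powR; rewrite ?nnegrE//; exact: ltW.
have Ii := lI i (mem_head _ _).
have Ij : I j by apply: lI; rewrite !inE eqxx orbT.
suff ij : i = j by move: ul; rewrite /= inE ij eqxx.
apply: dis => //; exists x; rewrite /cball/=.
rewrite (cI i Ii) (cI j Ij) mdistE distxx.
by split; apply: ltW; [case/andP: (rI _ Ii)|case/andP: (rI _ Ij)].
Qed.

Lemma packing_premeasure0_eq0 t A (K e d0 : R) : (0 < e)%R -> (0 < d0)%R ->
  (0 <= K)%R ->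
  (forall d, (0 < d)%R -> (d < d0)%R -> packing_premeasure t d A <= (K * d `^ e)%:E) ->
  packing_premeasure0 t A = 0.
Proof.
move=> e0 d00 K0 h; apply/eqP; rewrite eq_le packing_premeasure0_ge0 andbT.
apply/lee_addgt0Pr => g g0; rewrite add0e.
have [m1 hm1] := pow2_large (K / g)%R e0.
have [m2 hm2] := pow2_small d00.
pose m := maxn m1 m2.+1.
have dm : (pow2 (- m%:R) < d0)%R.
  rewrite (lt_le_trans _ (hm2 m2 _))// pow2_lt ltrN2 ltr_nat.
  by rewrite (leq_maxr m1 m2.+1).
apply: (@le_trans _ _ (packing_premeasure t (pow2 (- m%:R)) A)).
  by apply: ereal_inf_lbound; exists (pow2 (- m%:R)) => //=; exact: pow2_gt0.
apply: le_trans (h _ (pow2_gt0 _) dm) _.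
rewrite lee_fin powR_pow2 mulNr pow2N ler_pdivrMr ?pow2_gt0//.
by rewrite mulrC -ler_pdivrMr// mulrC mulrC [(m%:R * e)%R]mulrC hm1// leq_maxl.
Qed.

(** The space is covered by its pieces and the constant sequence [true]. *)
Lemma packing_dim_le s : (0 <= s)%R ->
  (forall k, exists b, forall m, (M k m)%:R <= s * m%:R + b)%R ->
  packing_dim X <= s%:E.
Proof.
move=> s0 h; apply/lee_addgt0Pr => e e0.
have se0 : (0 < s + e)%R by rewrite ltr_wpDl.
apply: ereal_inf_lbound; exists (s + e)%R => //; split; first exact: ltW.
apply/eqP; rewrite eq_le; apply/andP; split; last first.
  apply: le_ereal_inf_tmp => _ [F _ <-].
  by apply: nneseries_ge0 => i _ _; exact: packing_premeasure0_ge0.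
pose F i : set X := if i is k.+1 then piece k else [set (fun=> true)].
apply: ereal_inf_lbound; exists F => [y _|].
  have [ex|yt] := pselect (exists i, ~~ y i); last first.
    exists 0%N => //=; apply/funext => i.
    by apply/negPn/negP => yi; apply: yt; exists i.
  case: (ex_minnP ex) => k /negbTE yk kmin; exists k.+1 => //=; split=> // i ik.
  by apply/negPn/negP => /kmin; rewrite leqNgt ik.
rewrite eseries0// => -[|k] _ _ /=.
  apply: (@packing_premeasure0_eq0 _ _ 1 (s + e) 1) => // d d0 _.
  by rewrite mul1r packing_singleton// ltW.
have [b hb] := h k.
apply: (@packing_premeasure0_eq0 _ _ (pow2 (k.+1%:R + b + s)) e (pow2 (- k%:R))) => //.
- exact: pow2_gt0.
- exact: pow2_ge0.
- by move=> d d0 dk; exact: packing_piece.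
Qed.

(** In a countable cover one member is dense in some cylinder of the [0]-th
    piece (Baire). *)
Lemma baire (F : nat -> set X) : [set: X] `<=` \bigcup_i F i ->
  exists i z l, [/\ z 0%N = false, (0 < l)%N &
    forall z' l', (l <= l')%N -> agree l z z' -> exists2 y, F i y & agree l' z' y].
Proof.
move=> cov; apply: contrapT => no.
(* Cylinders of the 0-th piece that miss the j-th member of the cover: the
   property is shifted by one, so that it is void for j = 0. *)
pose P j (p : (nat -> bool) * nat) := [/\ p.1 0%N = false, (0 < p.2)%N &
  if j is i.+1 then forall y, F i y -> ~~ agree p.2 p.1 y else True].
have step j p : P j p ->
    exists q, [/\ P j.+1 q, agree p.2 p.1 q.1 & (p.2 < q.2)%N].
  case: p => z l [/= z0 l0 _]; apply: contrapT => no'; apply: no.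
  exists j, z, l; split=> // z' l' ll' zz'; apply: contrapT => no''; apply: no'.
  exists (z', l'.+1); split=> //=; split=> //=.
    by have /agreeP <- := zz'.
  move=> y Fy; apply/negP => zy; apply: no''; exists y => //.
  exact: agree_le zy.
have P0 : P 0%N (fun=> false, 1%N) by [].
have [y [_ hy]] := nested step P0.
have [i _ Fy] := cov y I; have [p [[_ _ hp] py _]] := hy i.+1.
by have := hp y Fy; rewrite py.
Qed.

(** Since [A] is dense in the cylinder, all the balls of radius [2^-m] in the
    cylinder have centers in [A]. *)
Lemma packing_premeasure0_ge1 s t A z l : (0 <= t)%R -> (t < s)%R ->
  z 0%N = false -> (0 < l)%N ->
  (forall N, exists m, (N <= m)%N /\ (s * m%:R <= (M 0 m)%:R)%R) ->
  (forall z' l', (l <= l')%N -> agree l z z' -> exists2 y, A y & agree l' z' y) ->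
  1 <= packing_premeasure0 t A.
Proof.
move=> t0 ts z0 l0 hs dense; apply: le_ereal_inf_tmp => _ [d /= d0 <-].
have st0 : (0 < s - t)%R by rewrite subr_gt0.
have [m1 hm1] := pow2_small (d0 : 0 < d)%R.
have [m2 hm2] := prof_unbounded M 0 l.
have [m3 hm3] := pow2_large (pow2 l%:R : R) st0.
have [m [mm sm]] := hs (maxn m1.+1 (maxn m2 m3)).
move: mm; rewrite !geq_max => /and3P[m1m m2m m3m].
have lM : (l <= 1 + M 0 m)%N.
  by rewrite (leq_trans hm2)// (leq_trans (prof_le M 0 m2m))// leq_addl.
pose p := (1 + M 0 m - l)%N; have lp : (l + p = 1 + M 0 m)%N by rewrite subnKC.
have pick (w : p.-tuple bool) : exists y, A y /\ agree (l + p) (graft z l w) y.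
  have [||y Ay wy] := dense (graft z l w) (l + p)%N; first exact: leq_addr.
    by rewrite agree_sym graft_agree.
  by exists y.
have [c0 hc0] := choice pick.
pose w0 : p.-tuple bool := [tuple of nseq p false].
pose c i := c0 (nth w0 (enum {: p.-tuple bool}) i).
have cz i : agree l z (c i).
  have [_ h] := hc0 (nth w0 (enum {: p.-tuple bool}) i).
  rewrite agree_sym.
  apply: (@agree_trans _ (graft z l (nth w0 (enum {: p.-tuple bool}) i))).
    by rewrite agree_sym; apply: agree_le h; exact: leq_addr.
  exact: graft_agree.
have c00 i : c i 0%N = false by have /agreeP <- := cz i.
have cl i y : close M m (c i) y = agree (l + p) (c i) y.
  by rewrite lp (@close_piece M _ m 0%N)//; exact: leq_ltn_trans m1m.
pose N := (2 ^ p)%N.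
have szN : size (enum {: p.-tuple bool}) = N.
  by rewrite -cardE card_tuple card_bool.
apply: le_ereal_sup_tmp.
exists (\esum_(i in `I_N) (pow2 (- m%:R) `^ t)%:E).
  exists `I_N, c, (fun=> pow2 (- m%:R)); split=> //; split.
  - move=> i _; rewrite pow2_gt0/= (lt_le_trans _ (hm1 m1 _))//.
    by rewrite pow2_lt ltrN2 ltr_nat.
  - by move=> i _; have [] := hc0 (nth w0 (enum {: p.-tuple bool}) i).
  - move=> i j /= iN jN [y []]; rewrite !cball_pow2 /= !cl => iy jy.
    have cij : agree (l + p) (c i) (c j).
      by apply: agree_trans iy _; rewrite agree_sym.
    have win k : window l p (c k) = nth w0 (enum {: p.-tuple bool}) k.
      have [_ h] := hc0 (nth w0 (enum {: p.-tuple bool}) k).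
      by move: h; rewrite agree_window window_graft => /andP[_ /eqP <-].
    move: cij; rewrite agree_window !win => /andP[_].
    by rewrite nth_uniq ?szN ?enum_uniq// => /eqP.
rewrite esum_fset//; last by move=> i _; rewrite lee_fin powR_ge0.
rewrite -fsbig_ord sumEFin lee_fin sumr_const card_ord -[(_ *+ N)%R]mulr_natl.
rewrite /N -pow2_nat powR_pow2 -pow2D pow2_ge1.
have pE : (p%:R = 1 + (M 0 m)%:R - l%:R :> R)%R by rewrite natrB// natrD.
have := hm3 m m3m; rewrite pow2_le pE; lra.
Qed.

Lemma packing_dim_ge s :
  (forall N, exists m, (N <= m)%N /\ (s * m%:R <= (M 0 m)%:R)%R) ->
  s%:E <= packing_dim X.
Proof.
move=> hs; apply: le_ereal_inf_tmp => _ [t [t0 Pt] <-].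
rewrite lee_fin leNgt; apply/negP => ts.
have : packing_measure t [set: X] < 1 by rewrite Pt lte_fin.
move=> /ereal_inf_lt[_ [F cov <-]]; apply/negP; rewrite -leNgt.
have [i [z [l [z0 l0 dense]]]] := baire cov.
apply: (@le_trans _ _ (packing_premeasure0 t (F i))).
  exact: packing_premeasure0_ge1 t0 ts z0 l0 hs dense.
apply: le_trans (@nneseries_lim_ge _ _ xpredT 0 i.+1 _).
  rewrite big_nat_recr//= leeDr// sume_ge0// => k _.
  exact: packing_premeasure0_ge0.
by move=> k _ _; exact: packing_premeasure0_ge0.
Qed.

End packing.

(** * Prescribing the growth of the pieces *)

(** The start of the [i]-th block, which ends just before [bstart i.+1].  As
    [bstart i.+1] is the square of [bstart i], each block outweighs all the
    preceding ones, even when their length is multiplied by their number. *)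
Definition bstart (i : nat) : nat := (2 ^ 2 ^ i)%N.

(** The index of the block of [j].  The numbers [0] and [1], which precede the
    start of the [0]-th block, are assigned to it. *)
Definition block (j : nat) : nat := trunc_log 2 (trunc_log 2 j).

Lemma bstart_gt0 i : (0 < bstart i)%N. Proof. by rewrite expn_gt0. Qed.

Lemma bstartS i : bstart i.+1 = (bstart i * bstart i)%N.
Proof. by rewrite /bstart expnS mulnC expnM -mulnn. Qed.

Lemma bstart_gt i : (i.+1 < bstart i)%N.
Proof. by apply: (@leq_ltn_trans (2 ^ i)%N); exact: ltn_expl. Qed.

Lemma bstart_le i j : (i <= j)%N -> (bstart i <= bstart j)%N.
Proof. by move=> ij; rewrite /bstart !leq_exp2l. Qed.

Lemma block_ge i j : (bstart i <= j)%N -> (i <= block j)%N.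
Proof. by move=> ij; rewrite /block !trunc_log_max. Qed.

Lemma block_le i j : (j < bstart i.+1)%N -> (block j <= i)%N.
Proof.
move=> ji; rewrite -ltnS; have [->|j0] := posnP j; first by rewrite /block !trunc_log0.
have l2 : (trunc_log 2 j < 2 ^ i.+1)%N.
  rewrite -(@ltn_exp2l 2)//; apply: leq_ltn_trans ji.
  exact: trunc_logP.
have [e|l0] := posnP (trunc_log 2 j); first by rewrite /block e trunc_log0.
rewrite -(@ltn_exp2l 2)//; apply: leq_ltn_trans l2.
exact: trunc_logP.
Qed.

Lemma blockE i j : (bstart i <= j)%N -> (j < bstart i.+1)%N -> block j = i.
Proof. by move=> /block_ge ij /block_le ji; apply/eqP; rewrite eqn_leq ij ji. Qed.

Lemma bstart_add i : (bstart i + i <= bstart i.+1)%N.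
Proof.
rewrite bstartS; have it := bstart_gt i.
apply: (@leq_trans (2 * bstart i)%N); last first.
  by rewrite leq_mul2r (leq_ltn_trans _ it) ?orbT.
by rewrite mul2n -addnn leq_add2l (leq_trans _ (ltnW it)).
Qed.

(** This makes [i * i] negligible compared with [bstart i]. *)
Lemma bstart_cube i : (i * i * i <= bstart i)%N.
Proof.
case: i => [|[|i]] //; elim: i => [|i ih]; first by [].
rewrite bstartS (leq_trans _ (leq_mul ih ih))//; nia.
Qed.

Lemma lt_bstart_block i j : block j = i -> (j < bstart i.+1)%N.
Proof. by move=> ji; rewrite ltnNge; apply/negP => /block_ge; rewrite ji ltnn. Qed.

Lemma bstart_block_le j : (0 < block j)%N -> (bstart (block j) <= j)%N.
Proof.
case e : (block j) => [|i] // _; rewrite leqNgt; apply/negP => /block_le.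
by rewrite e ltnn.
Qed.

Section profile_of_dimensions.
Variable R : realType.
Implicit Types (a : \bar R) (s e b : R) (i k m n : nat).

(** Finite approximations from below of a possibly infinite dimension. *)
Definition cap a i : R := fine (mine a i%:R%:E).

Lemma capE a i : (0 <= a)%E -> (cap a i)%:E = mine a i%:R%:E.
Proof. by rewrite /cap; case: a => [r||]// _; rewrite ?minye// -EFin_min. Qed.

Lemma cap_ge0 a i : (0 <= a)%E -> 0 <= cap a i.
Proof. by move=> a0; rewrite -lee_fin capE// le_min a0 lee_fin/=. Qed.

Lemma cap_le_nat a i : (0 <= a)%E -> cap a i <= i%:R.
Proof. by move=> a0; rewrite -lee_fin capE// ge_min lexx orbT. Qed.

Lemma cap_le a i s : (0 <= a)%E -> (a <= s%:E)%E -> cap a i <= s.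
Proof.
by move=> a0 as'; rewrite -lee_fin capE// (le_trans _ as')// ge_min lexx.
Qed.

Lemma cap_mono a a' i : (0 <= a)%E -> (a <= a')%E -> cap a i <= cap a' i.
Proof.
move=> a0 aa'; rewrite -lee_fin !capE// ?(le_trans a0)//.
by rewrite le_min !ge_min aa' lexx orbT.
Qed.

Lemma cap_ge a i s : (0 <= a)%E -> (s%:E <= a)%E -> s <= i%:R -> s <= cap a i.
Proof.
by move=> a0 sa si; rewrite -lee_fin capE// le_min sa lee_fin.
Qed.

(** ** Harmonic sums *)

Lemma sum_indicator J m n : \sum_(m <= j < n) (j < J)%:R <= (J - m)%:R :> R.
Proof.
have [nm|mn] := leqP n m; first by rewrite big_geq.
rewrite -natr_sum ler_nat (@leq_trans (minn (n - m) (J - m)))//; last exact: geq_minr.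
move: mn => /ltnW; elim: n => [|n ih]; first by rewrite leqn0 => /eqP->; rewrite big_geq.
rewrite leq_eqVlt => /orP[/eqP ->|]; first by rewrite big_geq.
by rewrite ltnS => mn; have := ih mn; rewrite big_nat_recr//=; case: ltnP => /= ? ?; lia.
Qed.

(** Harmonic sums grow more slowly than any linear function. *)
Lemma harmonic_sublinear e : 0 < e -> exists2 b, 0 <= b & forall m n,
  \sum_(m <= j < n) (j.+1%:R)^-1 <= e * (n - m)%:R + b :> R.
Proof.
move=> e0; pose J := (Num.trunc e^-1).+1; exists J%:R => // m n.
apply: (@le_trans _ _ (e * (n - m)%:R + \sum_(m <= j < n) (j < J)%:R)); last first.
  by rewrite lerD2l (le_trans (sum_indicator J m n))// ler_nat leq_subr.
have -> : e * (n - m)%:R = \sum_(m <= j < n) e.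
  by rewrite sumr_const_nat mulr_natr.
rewrite -big_split/=; apply: ler_sum => j _; have [jJ|Jj] := ltnP j J.
  by rewrite -[leLHS]add0r lerD ?(ltW e0)// invf_le1// ler1n.
rewrite addr0 -[e]invrK lef_pV2 ?posrE ?invr_gt0//.
rewrite ltW// (lt_le_trans (truncnS_gt _))// ler_nat.
by rewrite leqW.
Qed.

Lemma harmonic_unbounded p : p%:R / 2 <= \sum_(0 <= j < 2 ^ p) (j.+1%:R)^-1 :> R.
Proof.
elim: p => [|p ih]; first by rewrite mul0r sumr_ge0.
rewrite (@big_cat_nat _ _ _ (2 ^ p))//= ?leq_exp2l//.
rewrite -natr1 mulrDl lerD//.
apply: (@le_trans _ _ (\sum_(2 ^ p <= j < 2 ^ p.+1) ((2 ^ p.+1)%:R)^-1)).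
  have -> : \sum_(2 ^ p <= j < 2 ^ p.+1) ((2 ^ p.+1)%:R)^-1 =
      (2 ^ p.+1)%:R^-1 * (2 ^ p)%:R :> R.
    by rewrite sumr_const_nat mulr_natr expnS mul2n -addnn addnK.
  by rewrite expnS natrM invfM mulfVK ?mul1r// pnatr_eq0 -lt0n expn_gt0.
rewrite [leLHS]big_nat [leRHS]big_nat; apply: ler_sum => j /andP[_ jp].
by rewrite lef_pV2 ?posrE ?ltr0n ?expn_gt0// ler_nat.
Qed.

(** ** The slopes *)

Variables a1 a2 a3 a4 : \bar R.
Hypotheses (a1_ge0 : (0 <= a1)%E) (a12 : (a1 <= a2)%E) (a23 : (a2 <= a3)%E)
  (a34 : (a3 <= a4)%E).

Let a2_ge0 : (0 <= a2)%E. Proof. exact: le_trans a12. Qed.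
Let a3_ge0 : (0 <= a3)%E. Proof. exact: le_trans a23. Qed.
Let a4_ge0 : (0 <= a4)%E. Proof. exact: le_trans a34. Qed.

(** The growth rate of the [k]-th piece between the scales [j] and [j + 1], up to
    truncation of the rates.  All pieces alternate between the rates [a1] and
    [a2] on even and odd blocks, except that for odd [k] the [k]-th piece grows
    on the [k]-th block at rate [a4] for a time [k], and then at rate [a3]. *)
Definition slope k j : R :=
  let i := block j in
  if odd i then
    if i == k then (if (j < bstart k + k)%N then cap a4 i else cap a3 i) else cap a2 i
  else cap a1 i.

(** The harmonic term makes [growth k] unbounded even if all rates vanish. *)
Definition growth k m : R := \sum_(0 <= j < m) (slope k j + (j.+1%:R)^-1).

Lemma slope_ge k j : cap a1 (block j) <= slope k j.
Proof.
rewrite /slope; case: ifP => // _; case: ifP => _; last exact: cap_mono.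
case: ifP => _; apply: cap_mono => //; last exact: le_trans a23.
exact: le_trans (le_trans a12 a23) a34.
Qed.

Lemma slope_le_nat k j : slope k j <= (block j)%:R.
Proof. by rewrite /slope; do 3 ?case: ifP => _; exact: cap_le_nat. Qed.

Lemma slope_le k j : slope k j <= cap a4 (block j).
Proof.
rewrite /slope; do 3 ?case: ifP => _ //; apply: cap_mono => //.
  exact: le_trans a34.
exact: le_trans a12 (le_trans a23 a34).
Qed.

Lemma growthB k m n : (m <= n)%N ->
  growth k n - growth k m = \sum_(m <= j < n) (slope k j + (j.+1%:R)^-1).
Proof.
by move=> mn; rewrite /growth (@big_cat_nat _ _ _ m 0 n)//= addrAC subrr add0r.
Qed.

Lemma growth_ge s k m n : (m <= n)%N ->
  (forall j, (m <= j)%N -> (j < n)%N -> s <= slope k j) ->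
  s * (n%:R - m%:R) <= growth k n - growth k m.
Proof.
move=> mn h; rewrite growthB// -natrB// mulr_natr -sumr_const_nat.
rewrite [leLHS]big_nat [leRHS]big_nat; apply: ler_sum => j /andP[mj jn].
by rewrite (le_trans (h j mj jn))// lerDl invr_ge0.
Qed.

(** The function [v] stands for the excess of the slope over the rate [s]; the
    harmonic terms are absorbed by [e] and the constant. *)
Lemma growth_le s e : 0 < e -> exists2 b, 0 <= b & forall (v : nat -> R) k m n,
  (m <= n)%N -> (forall j, (m <= j)%N -> (j < n)%N -> slope k j <= s + v j) ->
  growth k n - growth k m <=
    (s + e) * (n%:R - m%:R) + \sum_(m <= j < n) v j + b.
Proof.
move=> e0; have [b b0 hb] := harmonic_sublinear e0; exists b => // v k m n mn h.
rewrite growthB// big_split/= mulrDl.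
have -> : s * (n%:R - m%:R) + e * (n%:R - m%:R) + \sum_(m <= j < n) v j + b =
    (s * (n%:R - m%:R) + \sum_(m <= j < n) v j) + (e * (n%:R - m%:R) + b).
  by ring.
rewrite lerD//; last by rewrite -natrB.
rewrite -natrB// mulr_natr -sumr_const_nat -big_split/=.
by rewrite [leLHS]big_nat [leRHS]big_nat; apply: ler_sum => j /andP[mj jn]; exact: h.
Qed.

Lemma growth_mono k m n : (m <= n)%N -> growth k m <= growth k n.
Proof.
move=> mn; rewrite -subr_ge0; apply: le_trans (@growth_ge 0 k m n mn _).
  by rewrite mul0r.
by move=> j _ _; apply: le_trans (slope_ge k j); exact: cap_ge0.
Qed.

Lemma growth0 k : growth k 0 = 0. Proof. by rewrite /growth big_geq. Qed.

Lemma growth_ge0 k m : 0 <= growth k m.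
Proof. by rewrite -(growth0 k) growth_mono. Qed.

(** Rounding [growth], and subtracting its value at [k] to have the [k]-th piece
    start at scale [k]; the truncated subtraction yields 0 before. *)
Definition growth_nat k m : nat := (Num.trunc (growth k m) - Num.trunc (growth k k))%N.

Lemma growth_nat_step k m : (growth_nat k m <= growth_nat k m.+1)%N.
Proof. by rewrite leq_sub2r// le_truncn// growth_mono. Qed.

Lemma growth_nat_diag k : growth_nat k k = 0%N.
Proof. exact: subnn. Qed.

Lemma growth_nat_unbounded k (b : nat) : exists m, (b <= growth_nat k m)%N.
Proof.
pose c := (b + Num.trunc (growth k k))%N; exists (2 ^ c.*2)%N.
suff : (c <= Num.trunc (growth k (2 ^ c.*2)))%N.
  by move=> /(leq_sub2r (Num.trunc (growth k k))); rewrite /c addnK.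
rewrite truncn_ge_nat ?growth_ge0//.
have := harmonic_unbounded c.*2; rewrite -mul2n natrM mulrC mulKf ?pnatr_eq0//.
move=> /le_trans; apply; apply: ler_sum => j _.
rewrite lerDr; apply: le_trans (slope_ge k j); exact: cap_ge0.
Qed.

Definition growth_profile : profile :=
  Profile growth_nat_step growth_nat_diag growth_nat_unbounded.

Let M := growth_profile.

Lemma profile_le_growth k m : (M k m)%:R <= growth k m.
Proof.
rewrite (@le_trans _ _ (Num.trunc (growth k m))%:R)//.
  by rewrite ler_nat leq_subr.
by rewrite truncn_le growth_ge0.
Qed.

Lemma profileB_le k m n : (m <= n)%N ->
  (M k n)%:R - (M k m)%:R <= growth k n - growth k m + 1.
Proof.
move=> mn; rewrite -natrB; last exact: prof_le.
have tmn := le_truncn (growth_mono k mn).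
rewrite (@le_trans _ _ ((Num.trunc (growth k n))%:R - (Num.trunc (growth k m))%:R))//.
  by rewrite -natrB// ler_nat /M/= /growth_nat; lia.
have := truncnS_gt (growth k m); rewrite -natr1.
have : (Num.trunc (growth k n))%:R <= growth k n by rewrite truncn_le growth_ge0.
lra.
Qed.

Lemma profileB_ge k m n : (k <= m)%N -> (m <= n)%N ->
  growth k n - growth k m - 1 <= (M k n)%:R - (M k m)%:R.
Proof.
move=> km mn; rewrite !natrB ?le_truncn ?growth_mono//; last exact: leq_trans mn.
have := truncnS_gt (growth k n); rewrite -natr1.
have : (Num.trunc (growth k m))%:R <= growth k m by rewrite truncn_le growth_ge0.
lra.
Qed.

Lemma bstart_dominates e : 0 < e ->
  exists i0, forall i, (i0 <= i)%N -> i%:R * i%:R <= e * (bstart i)%:R.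
Proof.
move=> e0; exists (Num.trunc e^-1).+1 => i ii.
have ei : 1 <= e * i%:R.
  rewrite mulrC -ler_pdivrMr// div1r ltW// (lt_le_trans (truncnS_gt _))//.
  by rewrite ler_nat.
apply: (@le_trans _ _ (e * (i * i * i)%:R)); last first.
  by rewrite ler_pM2l// ler_nat bstart_cube.
apply: (@le_trans _ _ (e * i%:R * (i%:R * i%:R))); last by rewrite !natrM !mulrA.
by rewrite -[leLHS]mul1r ler_wpM2r// mulr_ge0.
Qed.

Lemma bstart_dominates_uniform e : 0 < e ->
  exists2 b, 0 <= b & forall i, i%:R * i%:R <= e * (bstart i)%:R + b.
Proof.
move=> e0; have [i0 h] := bstart_dominates e0; exists (i0%:R * i0%:R).
  by rewrite mulr_ge0.
move=> i; have [ii|/ltnW ii] := leqP i0 i.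
  by rewrite (le_trans (h i ii))// lerDl mulr_ge0.
rewrite (@le_trans _ _ (i0%:R * i0%:R))//; first by rewrite ler_pM// ler_nat.
by rewrite lerDr mulr_ge0// ltW.
Qed.

Lemma bstart_large e b : 0 < e ->
  exists i0, forall i, (i0 <= i)%N -> b <= e * (bstart i)%:R.
Proof.
move=> e0; exists (Num.trunc (b / e)).+1 => i ii.
rewrite mulrC -ler_pdivrMr// ltW// (lt_le_trans (truncnS_gt _))// ler_nat.
by rewrite (leq_trans ii)// ltnW// ltnW// bstart_gt.
Qed.

(** Growth at rate [s'] on a single long block entails growth at rate [s < s']
    up to the end of that block. *)
Lemma block_rate s s' : s < s' -> exists i0, forall i, (i0 <= i)%N ->
  forall x, s' * ((bstart i.+1)%:R - (bstart i)%:R) - 1 <= x -> s * (bstart i.+1)%:R <= x.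
Proof.
move=> ss; have ss0 : 0 < s' - s by rewrite subr_gt0.
have [i0 h] := bstart_large (`|s'| + 1) ss0; exists i0 => i ii x; apply: le_trans.
rewrite bstartS natrM; have := h i ii; set t : R := (bstart i)%:R => ht.
have t1 : 1 <= t by rewrite ler1n bstart_gt0.
have h1 : (`|s'| + 1) * t <= (s' - s) * t * t by rewrite ler_wpM2r//; lra.
have h2 : s' * t <= `|s'| * t by rewrite ler_wpM2r ?ler_norm//; lra.
by lra.
Qed.

Lemma rate_between a s : (s%:E < a)%E -> exists2 s', s < s' & (s'%:E <= a)%E.
Proof.
case: a => [r||]//=; first by rewrite lte_fin => sr; exists r.
by move=> _; exists (s + 1); rewrite ?ltrDl// leey.
Qed.

Lemma rate_above a s : (0 <= a)%E -> (a < s%:E)%E ->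
  exists r e, [/\ 0 <= r, 0 < e, (a <= r%:E)%E & s = r + e + e + e].
Proof.
case: a => [r||]//=; rewrite lee_fin lte_fin => r0 rs.
by exists r, ((s - r) / 3); split=> //; [lra|field].
Qed.

Lemma nat_above s : exists i0 : nat, forall i, (i0 <= i)%N -> s <= i%:R.
Proof.
exists (Num.trunc s).+1 => i ii; rewrite ltW// (lt_le_trans (truncnS_gt _))//.
by rewrite ler_nat.
Qed.

Lemma profile_hausdorff_ge s : (s%:E < a1)%E ->
  exists b, forall m, s * m%:R - b <= (M 0 m)%:R.
Proof.
move=> sa; have [i0 hi0] := nat_above s; pose J := bstart i0.
exists (`|s| * J%:R + 1) => m.
have sJ : s * J%:R <= `|s| * J%:R by rewrite ler_wpM2r// ler_norm.
have [Jm|mJ] := leqP J m; last first.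
  have : s * m%:R <= `|s| * J%:R.
    apply: (@le_trans _ _ (`|s| * m%:R)); first by rewrite ler_wpM2r// ler_norm.
    by rewrite ler_wpM2l// ler_nat ltnW.
  have : 0 <= (M 0 m)%:R :> R by [].
  lra.
have := @profileB_ge 0 0 m isT isT; rewrite prof_diag.
have := growth_mono 0 (leq0n J).
have : s * (m%:R - J%:R) <= growth 0 m - growth 0 J.
  apply: growth_ge => // j Jj _; apply: le_trans (slope_ge 0 j).
  by rewrite cap_ge ?(ltW sa)// hi0// block_ge.
lra.
Qed.

(** At the end of an even block, the [k]-th piece has either finished deviating
    before that block, or not yet started. *)
Lemma profile_hausdorff_le s : (a1 < s%:E)%E ->
  forall N, exists m, (N <= m)%N /\ forall k, (M k m)%:R <= s * m%:R.
Proof.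
move=> as' N; have [r [e [r0 e0 ar ->]]] := rate_above a1_ge0 as'.
have [b b0 hb] := growth_le r e0.
have [i1 hi1] := bstart_dominates e0; have [i2 hi2] := bstart_large b e0.
pose i := (N + i1 + i2).*2.
have [i1i i2i Ni] : [/\ i1 <= i, i2 <= i & N <= i]%N by rewrite /i; split; lia.
exists (bstart i.+1); split.
  by rewrite (leq_trans Ni)// (leq_trans _ (ltnW (bstart_gt i.+1)))// leqW// leqW.
move=> k; apply: le_trans (profile_le_growth k _) _.
have := hb (fun j => i%:R * (j < bstart i)%:R) k 0%N (bstart i.+1) (leq0n _).
rewrite growth0 !subr0 -mulr_sumr => h.
apply: le_trans (h _) _ => [j _ ji|].
  have [jT|Tj] := ltnP j (bstart i).
    rewrite mulr1 ler_wpDl// (le_trans (slope_le_nat k j))// ler_nat.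
    exact: block_le.
  rewrite mulr0 addr0 /slope (blockE Tj ji) /i odd_double.
  exact: cap_le.
have hS : i%:R * \sum_(0 <= j < bstart i.+1) (j < bstart i)%:R <= e * (bstart i.+1)%:R.
  apply: (@le_trans _ _ (i%:R * (bstart i)%:R)).
    by rewrite ler_wpM2l// (le_trans (sum_indicator _ _ _))// subn0.
  rewrite bstartS natrM mulrA ler_wpM2r// (le_trans _ (hi1 i i1i))//.
  by rewrite -natrM ler_nat; case: (i) => // n; rewrite leq_pmulr.
have hB : b <= e * (bstart i.+1)%:R.
  by rewrite (le_trans (hi2 i i2i))// ler_wpM2l ?(ltW e0)// ler_nat bstart_le.
lra.
Qed.

(** The deviation of the [k]-th piece is over at [bstart k.+1]. *)
Lemma profile_packing_le s : (a2 < s%:E)%E ->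
  forall k, exists b, forall m, (M k m)%:R <= s * m%:R + b.
Proof.
move=> as' k; have [r [e [r0 e0 ar ->]]] := rate_above a2_ge0 as'.
have [b b0 hb] := growth_le r e0.
exists (k%:R * (bstart k.+1)%:R + b) => m; apply: le_trans (profile_le_growth k _) _.
have := hb (fun j => k%:R * (j < bstart k.+1)%:R) k 0%N m (leq0n _).
rewrite growth0 !subr0 -mulr_sumr => h; apply: le_trans (h _) _ => [j _ _|].
  rewrite /slope; case: ifP => _; last first.
    by rewrite ler_wpDr ?mulr_ge0// cap_le// (le_trans a12).
  case: eqP => [jk|_]; last by rewrite ler_wpDr ?mulr_ge0// cap_le.
  rewrite (lt_bstart_block jk) mulr1 ler_wpDl// jk.
  by case: ifP => _; exact: cap_le_nat.
have : k%:R * \sum_(0 <= j < m) (j < bstart k.+1)%:R <= k%:R * (bstart k.+1)%:R :> R.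
  by rewrite ler_wpM2l// (le_trans (sum_indicator _ _ _))// subn0.
have : 0 <= e * m%:R by rewrite mulr_ge0// ltW.
lra.
Qed.

Lemma profile_packing_ge s : (s%:E < a2)%E ->
  forall N, exists m, (N <= m)%N /\ s * m%:R <= (M 0 m)%:R.
Proof.
move=> /rate_between[s' ss sa] N; have [i0 hi0] := nat_above s'.
have [i1 hi1] := block_rate ss; pose i := (N + i0 + i1).*2.+1.
have [i0i i1i Ni] : [/\ i0 <= i, i1 <= i & N <= i]%N by rewrite /i; split; lia.
exists (bstart i.+1); split.
  by rewrite (leq_trans Ni)// (leq_trans _ (ltnW (bstart_gt i.+1)))// leqW// leqW.
apply: (hi1 i i1i); have := @profileB_ge 0 0 (bstart i.+1) isT isT; rewrite prof_diag.
have := growth_mono 0 (leq0n (bstart i)).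
have : s' * ((bstart i.+1)%:R - (bstart i)%:R) <=
    growth 0 (bstart i.+1) - growth 0 (bstart i).
  apply: growth_ge => [|j Tj jT]; first exact: bstart_le.
  by rewrite /slope (blockE Tj jT) /i/= odd_double/= cap_ge ?hi0.
lra.
Qed.

(** The fast growth at rate [a4] contributes at most [k * k], which is
    negligible compared with the scale [bstart k] where it takes place. *)
Lemma profile_box_le s : (a3 < s%:E)%E ->
  exists b, forall k m, (M k m)%:R <= s * m%:R + b.
Proof.
move=> as'; have [r [e [r0 e0 ar ->]]] := rate_above a3_ge0 as'.
have [b b0 hb] := growth_le r e0; have [c c0 hc] := bstart_dominates_uniform e0.
exists (b + b + c) => k m; apply: le_trans (profile_le_growth k _) _.
have slr j : slope k j <= r + k%:R * ((bstart k <= j) && (j < bstart k + k))%N%:R.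
  rewrite /slope; case: ifP => [oj|_]; last first.
    by rewrite ler_wpDr ?mulr_ge0// cap_le// (le_trans a12)// (le_trans a23).
  case: eqP => [jk|_]; last by rewrite ler_wpDr ?mulr_ge0// cap_le// (le_trans a23).
  case: ifP => [jT|_]; last by rewrite ler_wpDr ?mulr_ge0// cap_le.
  have Tj : (bstart k <= j)%N by rewrite -jk bstart_block_le// odd_gt0.
  by rewrite Tj jk mulr1 ler_wpDl// cap_le_nat.
have em : 0 <= e * m%:R by rewrite mulr_ge0// ltW.
have h0 n : (n <= bstart k)%N -> growth k n <= (r + e) * n%:R + b.
  move=> nT; have := hb (fun=> 0) k 0%N n (leq0n _).
  rewrite growth0 !subr0 big1// addr0 => h.
  apply: le_trans (h _) _ => [j _ jn|]; last by lra.
  by rewrite (le_trans (slr j))// leqNgt (leq_trans jn nT)/= mulr0 !addr0.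
have [mT|Tm] := leqP m (bstart k).
  by rewrite (le_trans (h0 m mT))//; lra.
have := h0 _ (leqnn (bstart k)).
have := hb (fun j => k%:R * (j < bstart k + k)%:R) k _ m (ltnW Tm) _.
rewrite -mulr_sumr => h.
have {}h : growth k m - growth k (bstart k) <= (r + e) * (m%:R - (bstart k)%:R) +
    k%:R * \sum_(bstart k <= j < m) (j < bstart k + k)%:R + b.
  by apply: h => j Tj _; rewrite (le_trans (slr j))// Tj.
have : k%:R * \sum_(bstart k <= j < m) (j < bstart k + k)%:R <= k%:R * k%:R :> R.
  by rewrite ler_wpM2l// (le_trans (sum_indicator _ _ _))// addKn.
have := hc k.
have : e * (bstart k)%:R <= e * m%:R by rewrite ler_pM2l// ler_nat ltnW.
lra.
Qed.

Lemma profile_box_ge s : (s%:E < a3)%E -> forall N, exists k n,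
  [/\ (N <= n)%N, (k < n)%N & s * n%:R <= (M k n)%:R - (M k k.+1)%:R].
Proof.
move=> /rate_between[s' ss sa] N; have [i0 hi0] := nat_above s'.
have [i1 hi1] := block_rate ss; pose i := (N + i0 + i1).*2.+1.
have [i0i i1i Ni] : [/\ i0 <= i, i1 <= i & N <= i]%N by rewrite /i; split; lia.
have iT : (i.+1 < bstart i.+1)%N by rewrite ltnW// bstart_gt.
exists i, (bstart i.+1); split.
- by rewrite (leq_trans Ni)// ltnW// ltnW.
- exact: ltnW.
apply: (hi1 i i1i).
have := @profileB_ge i i.+1 (bstart i.+1) (leqnSn i) (ltnW iT).
have := growth_mono i (ltnW (bstart_gt i)).
have : s' * ((bstart i.+1)%:R - (bstart i)%:R) <=
    growth i (bstart i.+1) - growth i (bstart i).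
  apply: growth_ge => [|j Tj jT]; first exact: bstart_le.
  rewrite /slope (blockE Tj jT) eqxx [odd i]/= odd_double/=.
  by case: ifP => _; rewrite cap_ge ?hi0// (le_trans sa).
lra.
Qed.

Lemma profile_assouad_le s : (a4 < s%:E)%E ->
  exists b, forall k m n, (m <= n)%N ->
    (M k n)%:R - (M k m)%:R <= s * (n%:R - m%:R) + b.
Proof.
move=> as'; have [r [e [r0 e0 ar ->]]] := rate_above a4_ge0 as'.
have [b b0 hb] := growth_le r e0; exists (b + 1) => k m n mn.
apply: le_trans (profileB_le k mn) _.
have := hb (fun=> 0) k m n mn; rewrite big1// addr0 => h.
have {}h := h (fun j _ _ => le_trans (slope_le k j) (cap_le _ a4_ge0 ar)).
have : 0 <= e * (n%:R - m%:R) by rewrite mulr_ge0 ?(ltW e0)// subr_ge0 ler_nat.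
lra.
Qed.

Lemma profile_assouad_ge s : (s%:E < a4)%E -> forall b, exists k m n,
  [/\ (k < m)%N, (m < n)%N &
      s * (n%:R - m%:R) + b <= (M k n)%:R - (M k m)%:R].
Proof.
move=> /rate_between[s' ss sa] b; have [i0 hi0] := nat_above s'.
have [i1 hi1] := nat_above ((b + 1) / (s' - s)); pose k := (i0 + i1).*2.+1.
have [i0k i1k] : (i0 <= k)%N /\ (i1 <= k)%N by rewrite /k; split; lia.
exists k, (bstart k), (bstart k + k)%N; split; first exact: ltnW (bstart_gt k).
  by rewrite -addn1 leq_add2l.
have := @profileB_ge k (bstart k) (bstart k + k) (ltnW (ltnW (bstart_gt k)))
  (leq_addr _ _).
have : s' * ((bstart k + k)%:R - (bstart k)%:R) <=
    growth k (bstart k + k) - growth k (bstart k).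
  apply: growth_ge => [|j Tj jT]; first exact: leq_addr.
  rewrite /slope (blockE Tj (leq_trans jT (bstart_add k))) eqxx jT [odd k]/= odd_double/=.
  by rewrite cap_ge ?hi0.
have := hi1 k i1k; rewrite ler_pdivrMr ?subr_gt0// natrD addrAC subrr add0r; lra.
Qed.

End profile_of_dimensions.

(** * The four dimensions *)

Section ereal_bounds.
Variable R : realType.
Local Open Scope ereal_scope.
Implicit Types a x : \bar R.

Lemma le_of_lower_reals a x :
  (forall s : R, s%:E < a -> s%:E <= x) -> a <= x.
Proof.
case: a => [a| |] h; last by rewrite leNye.
- case: x h => [x| |] h; rewrite ?leey//.
    rewrite lee_fin leNgt; apply/negP => xa.
    have : ((x + a) / 2)%:E <= x%:E by apply: h; rewrite lte_fin; lra.
    by rewrite lee_fin; lra.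
  suff : (a - 1)%:E <= -oo by [].
  by apply: h; rewrite lte_fin; lra.
- case: x h => [x| |] h//.
    by have := h (x + 1)%R (ltry _); rewrite lee_fin gerDl ler10.
  by have := h 0%R (ltry _).
Qed.

Lemma ge_of_upper_reals a x : 0 <= a ->
  (forall s : R, a < s%:E -> x <= s%:E) -> x <= a.
Proof.
case: a => [a| |]//; last by move=> _ _; exact: leey.
move=> _ h; apply/lee_addgt0Pr => e e0; apply: h.
by rewrite lte_fin ltrDl.
Qed.

Lemma eq_of_reals a x : 0 <= a -> (forall s : R, s%:E < a -> s%:E <= x) ->
  (forall s : R, (0 <= s)%R -> a < s%:E -> x <= s%:E) -> x = a.
Proof.
move=> a0 lo up; apply/eqP; rewrite eq_le; apply/andP; split.
  apply: ge_of_upper_reals => // s as'; apply: up => //.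
  by rewrite -lee_fin (le_trans a0)// ltW.
exact: le_of_lower_reals.
Qed.

End ereal_bounds.

Local Open Scope ereal_scope.

Theorem theorem1p1 (R : realType) (a1 a2 a3 a4 : \bar R) :
  0 <= a1 -> a1 <= a2 -> a2 <= a3 -> a3 <= a4 ->
  exists X : metricType R,
    [/\ ultrametric X,
        homeomorphic X cantor_space &
        [/\ hausdorff_dim X = a1,
            packing_dim X = a2,
            upper_box_dim X = a3 &
            assouad_dim X = a4]].
Proof.
move=> a1_ge0 a12 a23 a34.
have a2_ge0 := le_trans a1_ge0 a12; have a3_ge0 := le_trans a2_ge0 a23.
have a4_ge0 := le_trans a3_ge0 a34.
exists (pspace R (growth_profile a1_ge0 a12 a23 a34)); split.
- exact: pspace_ultrametric.
- exact: pspace_homeomorphic.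
split; apply: eq_of_reals => // s.
- by move=> /(profile_hausdorff_ge a1_ge0 a12 a23 a34); exact: hausdorff_dim_ge.
- move=> s0 /(profile_hausdorff_le a1_ge0 a12 a23 a34).
  exact: hausdorff_dim_le.
- by move=> /(profile_packing_ge a1_ge0 a12 a23 a34); exact: packing_dim_ge.
- move=> s0 /(profile_packing_le a1_ge0 a12 a23 a34); exact: packing_dim_le.
- by move=> /(profile_box_ge a1_ge0 a12 a23 a34); exact: box_dim_ge.
- move=> s0 /(profile_box_le a1_ge0 a12 a23 a34); exact: box_dim_le.
- by move=> /(profile_assouad_ge a1_ge0 a12 a23 a34); exact: assouad_dim_ge.
- move=> s0 /(profile_assouad_le a1_ge0 a12 a23 a34); exact: assouad_dim_le.
Qed.
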